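(* Let $\mathfrak g$ be a finite-dimensional real Lie algebra with a reductive decomposition $\mathfrak g=\mathfrak h\oplus\mathfrak m$ (that is, $\mathfrak h$ is a Lie subalgebra and $[\mathfrak h,\mathfrak m]\subset\mathfrak m$), and assume that this decomposition is fat on an open submanifold $U\subseteq\mathfrak h^*$. Let $\phi:\wedge^2\mathfrak m\to\mathfrak h$ be the linear map $\phi(X,Y)=[X,Y]_{\mathfrak h}$, where $[X,Y]_{\mathfrak h}$ denotes the $\mathfrak h$-component of $[X,Y]$. For $\lambda\in U$ let $r(\lambda)\in\wedge^2\mathfrak m\subset\wedge^2\mathfrak g$ be the element obtained from the non-degenerate form $\phi^*(\lambda)\in\wedge^2\mathfrak m^*$, $\phi^*(\lambda)(X,Y)=\langle\lambda,[X,Y]_{\mathfrak h}\rangle$, by identifying $\mathfrak m^*$ with $\mathfrak m$ by means of $\phi^*(\lambda)$ itself; explicitly, for a basis $e_1,\dots,e_m$ of $\mathfrak m$, with $a_{ij}(\lambda)=\langle\lambda,[e_i,e_j]_{\mathfrak h}\rangle$ and $(c_{ij}(\lambda))$ the inverse matrix of $(a_{ij}(\lambda))$, $$r(\lambda)=\frac12\sum_{i,j}c_{ij}(\lambda)\,e_i\wedge e_j .$$ Then $r:U\to\wedge^2\mathfrak m\subset\wedge^2\mathfrak g$ is a non-degenerate triangular dynamical $r$-matrix.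
   Context: $G$ is a Lie group with Lie algebra $\mathfrak g$ and $H\subset G$ is the connected Lie subgroup with Lie algebra $\mathfrak h$. The decomposition $\mathfrak g=\mathfrak h\oplus\mathfrak m$ induces a left $G$-invariant connection on the principal $H$-bundle $G\to G/H$, whose curvature on left-invariant vector fields $X,Y$ belonging to $\mathfrak m$ is $\Omega(X,Y)=-[X,Y]_{\mathfrak h}$. The decomposition is fat on $U$ if $\langle\lambda,\Omega\rangle$ is non-degenerate on each horizontal space for every $\lambda\in U$; i.e. the skew form $(X,Y)\mapsto\langle\lambda,[X,Y]_{\mathfrak h}\rangle$ on $\mathfrak m$ is non-degenerate for every $\lambda\in U$. Let $\{h_i\}$ be a basis of $\mathfrak h$ and $(\lambda^i)$ the induced coordinates on $\mathfrak h^*$. A smooth function $r:U\to\wedge^2\mathfrak g$ is a triangular dynamical $r$-matrix if: (i) it is $H$-equivariant: with $\mathrm{Ad}_y^*\lambda=\lambda\circ\mathrm{Ad}_y$, one has $r(\mathrm{Ad}^*_{y^{-1}}\lambda)=\mathrm{Ad}_y r(\lambda)$ for $y\in H$ whenever $\lambda$ and $\mathrm{Ad}^*_{y^{-1}}\lambda$ lie in $U$; and (ii) $\sum_i h_i\wedge\frac{\partial r}{\partial\lambda^i}-\frac12[r,r]=0$, where $[\cdot,\cdot]$ is the Schouten bracket on $\wedge^\bullet\mathfrak g$, $[a_1\wedge\dots\wedge a_k,b_1\wedge\dots\wedge b_m]=\sum_{i,j}(-1)^{i+j}[a_i,b_j]\wedge a_1\wedge\dots\widehat{a_i}\dots\wedge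 a_k\wedge b_1\wedge\dots\widehat{b_j}\dots\wedge b_m$. Such an $r$ is non-degenerate if the associated Poisson structure $\pi=\pi_{\mathfrak h^*}+\sum_i\frac{\partial}{\partial\lambda^i}\wedge\overrightarrow{h_i}+\overrightarrow{r(\lambda)}$ on $U\times G$ is non-degenerate, i.e. symplectic. Here $\pi_{\mathfrak h^*}$ is the Lie--Poisson tensor on $\mathfrak h^*$, $\{\lambda_X,\lambda_Y\}=\lambda_{[X,Y]}$ where $\lambda_X(\lambda)=\langle\lambda,X\rangle$, and the arrows denote left-invariant (multi)vector fields along the $G$-factor. *)

(* Defs.v *)
From HB Require Import structures.
From mathcomp Require Import all_boot all_order all_algebra.
From mathcomp Require Import all_classical all_reals all_analysis.

Set Implicit Arguments.
Unset Strict Implicit.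
Unset Printing Implicit Defensive.

Import Order.TTheory GRing.Theory Num.Theory.
Import numFieldNormedType.Exports VectorInternalTheory.

Local Open Scope classical_set_scope.
Local Open Scope ring_scope.

(******************************************************************************)
(* Smoothness.                                                                *)
(* f is C^oo on the open set D when all its iterated directional derivatives  *)
(* are Frechet differentiable at every point of D.  A finite-dimensional      *)
(* vector space V carries the topology and smooth structure of 'rV[R]_(dim V),*)
(* through the linear isomorphisms v2r : V -> 'rV_(dim V) and r2v = v2r^-1.   *)
(******************************************************************************)

Definition smooth_on (R : realType) (V W : normedModType R) (D : set V)
    (f : V -> W) : Prop :=
  forall (vs : seq V) (x : V), D x ->
    differentiable (foldr (fun v (k : V -> W) => 'D_v k) f vs) x.

Definition vopen (R : realType) (V : vectType R) (D : set V) : Prop :=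
  open ((@r2v R V) @^-1` D).

Definition vsmooth_on (R : realType) (V W : vectType R) (D : set V)
    (f : V -> W) : Prop :=
  smooth_on ((@r2v R V) @^-1` D) (v2r \o f \o r2v).

Definition vderive (R : realType) (V W : vectType R) (f : V -> W) (x v : V) : W :=
  r2v ('D_(v2r v) (v2r \o f \o r2v) (v2r x)).

(******************************************************************************)
(* Exterior algebra of V.  With b_i := r2v (delta_mx 0 i) the standard basis  *)
(* of V, the value of w : ext V at A = {i_1 < ... < i_k} is the coefficient   *)
(* of b_{i_1} /\ ... /\ b_{i_k}.                                              *)
(******************************************************************************)

Definition ext (R : realType) (V : vectType R) : Type :=
  {ffun {set 'I_(dim V)} -> R^o}.

Definition ext1 (R : realType) (V : vectType R) : ext V :=
  [ffun A => (A == finset.set0)%:R].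

(* x /\ w *)
Definition ext_wedge1 (R : realType) (V : vectType R) (x : V) (w : ext V) : ext V :=
  [ffun A : {set 'I_(dim V)} => \sum_(i in A)
     (-1) ^+ #|[set j in A | (j < i)%N]|%SET * v2r x 0 i * w (A :\ i)%SET].

(* a_1 /\ ... /\ a_k for s = [:: a_1; ...; a_k] *)
Definition ext_wedge (R : realType) (V : vectType R) (s : seq V) : ext V :=
  foldr (@ext_wedge1 R V) (ext1 V) s.

(* interior product by the covector xi: the antiderivation of degree -1 that
   maps x to xi x; on bivectors, xi |-> ext_contract xi w is the map V^* -> V
   defined by w *)
Definition ext_contract (R : realType) (V : vectType R) (xi : 'Hom(V, R^o))
    (w : ext V) : ext V :=
  [ffun A : {set 'I_(dim V)} => \sum_(i | i \notin A)
     (-1) ^+ #|[set j in A | (j < i)%N]|%SET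
       * (xi (r2v (delta_mx 0 i)) : R) * w (i |: A)%SET].

(* the basis vectors indexed by A, in increasing order *)
Definition ext_basis (R : realType) (V : vectType R) (A : {set 'I_(dim V)}) :
    seq V :=
  [seq r2v (delta_mx 0 i) | i <- enum A].

(* the map induced on exterior algebras by the linear map f *)
Definition ext_map (R : realType) (V W : vectType R) (f : V -> W) (w : ext V) :
    ext W :=
  \sum_(A : {set 'I_(dim V)}) w A *: ext_wedge [seq f v | v <- ext_basis A].

(* the k-th exterior power of the subspace W, inside the exterior algebra *)
Definition ext_pow (R : realType) (V : vectType R) (k : nat) (W : {vspace V}) :
    {vspace ext V} :=
  <<[seq ext_wedge [seq (vbasis W)`_(nat_of_ord i) | i <- t]
      | t : k.-tuple 'I_(\dim W)]>>%VS.

(******************************************************************************)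
(* Lie algebras and the Schouten bracket                                      *)
(******************************************************************************)

Record lie_bracket (R : realType) (g : vectType R) (br : g -> g -> g) : Prop :=
  LieBracket {
    lie_linearl : forall y, linear (br^~ y);
    lie_linearr : forall x, linear (br x);
    lie_alt : forall x, br x x = 0;
    lie_jacobi : forall x y z, br x (br y z) + br y (br z x) + br z (br x y) = 0
  }.

Definition seq_omit (T : Type) (i : nat) (s : seq T) : seq T :=
  take i s ++ drop i.+1 s.

(* indices start at 0 here, which leaves the parity of i + j unchanged *)
Definition schouten_decomposable (R : realType) (g : vectType R)
    (br : g -> g -> g) (a b : seq g) : ext g :=
  \sum_(i < size a) \sum_(j < size b)
    (-1) ^+ (i + j) *: ext_wedge (br a`_i b`_j :: seq_omit i a ++ seq_omit j b).

Definition schouten (R : realType) (g : vectType R) (br : g -> g -> g)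
    (u w : ext g) : ext g :=
  \sum_(A : {set 'I_(dim g)}) \sum_(B : {set 'I_(dim g)})
    (u A * w B) *: schouten_decomposable br (ext_basis A) (ext_basis B).

(******************************************************************************)
(* Reductive decompositions and fatness                                       *)
(******************************************************************************)

Record reductive (R : realType) (g : vectType R) (br : g -> g -> g)
    (h m : {vspace g}) : Prop := Reductive {
  reductive_sum : (h + m = fullv)%VS;
  reductive_direct : (h :&: m = 0)%VS;
  reductive_subalgebra : forall x y, x \in h -> y \in h -> br x y \in h;
  reductive_invariant : forall x y, x \in h -> y \in m -> br x y \in m
}.

Definition vdual (R : realType) (V : vectType R) : vectType R := 'Hom(V, R^o).

Definition hdual (R : realType) (g : vectType R) (h : {vspace g}) : vectType R :=
  vdual (subvs_of h).

(* the h-component, along m *)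
Definition h_part (R : realType) (g : vectType R) (h m : {vspace g}) (X : g) :
    subvs_of h :=
  vsproj h (daddv_pi h m X).

(* phi^*(l) *)
Definition fat_form (R : realType) (g : vectType R) (br : g -> g -> g)
    (h m : {vspace g}) (l : hdual h) (X Y : g) : R :=
  (l : 'Hom(subvs_of h, R^o)) (h_part h m (br X Y)).

Definition fat_on (R : realType) (g : vectType R) (br : g -> g -> g)
    (h m : {vspace g}) (U : set (hdual h)) : Prop :=
  forall l, U l -> forall X, X \in m ->
    (forall Y, Y \in m -> fat_form br m l X Y = 0) -> X = 0.

Definition fat_rmatrix (R : realType) (g : vectType R) (br : g -> g -> g)
    (h m : {vspace g}) (e : (\dim m).-tuple g) (l : hdual h) : ext g :=
  let c := invmx (\matrix_(i, j) fat_form br m l e`_i e`_j) in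
  2^-1 *: \sum_(i < \dim m) \sum_(j < \dim m) c i j *: ext_wedge [:: e`_i; e`_j].

(******************************************************************************)
(* Smooth manifolds and Lie groups                                            *)
(******************************************************************************)

(* a homeomorphism cmap : cdom -> cmap @` cdom between open subsets of T and
   R^n, with inverse cinv; both functions are irrelevant elsewhere *)
Record chart (R : realType) (T : topologicalType) (n : nat) := Chart {
  cdom : set T;
  cmap : T -> 'rV[R]_n;
  cinv : 'rV[R]_n -> T;
  cdom_open : open cdom;
  cimg_open : open (cmap @` cdom);
  cmapK : forall x, cdom x -> cinv (cmap x) = x;
  cmap_continuous : forall x, cdom x -> {for x, continuous cmap};
  cinv_continuous : forall x, cdom x -> {for cmap x, continuous cinv}
}.

Definition cimg (R : realType) (T : topologicalType) (n : nat)
    (c : chart R T n) : set 'rV[R]_n :=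
  cmap c @` cdom c.

HB.mixin Record isManifold (R : realType) T of Topological T := {
  mdim : nat;
  atlas : set (chart R T mdim);
  manifold_hausdorff : hausdorff_space T;
  manifold_second_countable : @second_countable T;
  atlas_cover : forall x : T, exists2 c, atlas c & cdom c x;
  atlas_compat : forall c d, atlas c -> atlas d ->
    smooth_on [set x | cimg c x /\ cdom d (cinv c x)] (cmap d \o cinv c)
}.

#[short(type="manifoldType")]
HB.structure Definition Manifold (R : realType) :=
  {T of Topological T & isManifold R T}.

Definition smooth_map (R : realType) (M N : manifoldType R) (f : M -> N) : Prop :=
  continuous f /\
  forall c d, atlas c -> atlas d ->
    smooth_on [set x | cimg c x /\ cdom d (f (cinv c x))]
              (cmap d \o f \o cinv c).

(* smoothness of f : M x N -> P in the product charts of M x N *)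
Definition smooth_map2 (R : realType) (M N P : manifoldType R)
    (f : M -> N -> P) : Prop :=
  continuous (fun p : M * N => f p.1 p.2) /\
  forall c1 c2 d, atlas c1 -> atlas c2 -> atlas d ->
    smooth_on [set p : 'rV[R]_(@mdim R M) * 'rV[R]_(@mdim R N) |
                 [/\ cimg c1 p.1, cimg c2 p.2 &
                     cdom d (f (cinv c1 p.1) (cinv c2 p.2))]]
              (fun p => cmap d (f (cinv c1 p.1) (cinv c2 p.2))).

(* the tangent map T_x f : T_x M -> T_(f x) N, read in a chart c at x and a
   chart d at f x *)
Definition tmap (R : realType) (M N : manifoldType R)
    (c : chart R M (@mdim R M)) (d : chart R N (@mdim R N)) (f : M -> N)
    (x : M) : 'rV[R]_(@mdim R M) -> 'rV[R]_(@mdim R N) :=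
  'd (cmap d \o f \o cinv c) (cmap c x).

HB.mixin Record isLieGroup (R : realType) G of Manifold R G & Group G := {
  lie_mul_smooth : smooth_map2 (fun x y : G => (x * y)%g : G);
  lie_inv_smooth : smooth_map (fun x : G => (x^-1)%g : G)
}.

#[short(type="lieGroupType")]
HB.structure Definition LieGroup (R : realType) :=
  {G of Manifold R G & Group G & isLieGroup R G}.

(* a linear isomorphism from g to the tangent space of G at 1, the latter being
   read in a chart at 1 *)
Record tangent_iso (R : realType) (G : lieGroupType R) (g : vectType R) :=
  TangentIso {
    ti_chart : chart R G (@mdim R G);
    ti_atlas : atlas ti_chart;
    ti_dom1 : cdom ti_chart 1%g;
    ti_map :> 'Hom(g, 'rV[R]_(@mdim R G));
    ti_bij : bijective ti_map
  }.

(* Ad_y := T_1 (z |-> y z y^-1) *)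
Definition Ad (R : realType) (G : lieGroupType R) (g : vectType R)
    (t : tangent_iso G g) (y : G) (X : g) : g :=
  (t^-1)%VF (tmap (ti_chart t) (ti_chart t)
                  (fun z : G => (y * z * y^-1)%g : G) 1%g (t X)).

(* g with bracket br is the Lie algebra of G: [X, Y] = (T_1 Ad)(X)(Y), which is
   the value at 1 of the commutator of the left-invariant vector fields of X
   and Y *)
Definition lie_algebra_of (R : realType) (G : lieGroupType R) (g : vectType R)
    (t : tangent_iso G g) (br : g -> g -> g) : Prop :=
  forall X Y : g,
    'D_(t X) (fun x => t (Ad t (cinv (ti_chart t) x) Y)) (cmap (ti_chart t) 1%g)
    = t (br X Y).

(* the image of iota : K -> G is the connected Lie subgroup of G with Lie
   algebra h *)
Record connected_lie_subgroup (R : realType) (G : lieGroupType R)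
    (g : vectType R) (t : tangent_iso G g) (h : {vspace g})
    (K : lieGroupType R) (iota : K -> G) : Prop := ConnectedLieSubgroup {
  clsub_connected : connected [set: K];
  clsub_morph : forall x y : K, iota (x * y)%g = (iota x * iota y)%g;
  clsub_smooth : smooth_map iota;
  clsub_inj : injective iota;
  clsub_immersion : forall c d x, atlas c -> atlas d -> cdom c x ->
    cdom d (iota x) -> injective (tmap c d iota x);
  clsub_lie : forall c, atlas c -> cdom c 1%g -> forall X : g,
    X \in h <-> exists v, t X = tmap c (ti_chart t) iota 1%g v
}.

(******************************************************************************)
(* Triangular dynamical r-matrices                                            *)
(******************************************************************************)

(* Ad^*_y l := l \o Ad_y on h^*, for y in H (so that Ad_y preserves h and
   vsproj h is only a change of type) *)
Definition coAd (R : realType) (G : lieGroupType R) (g : vectType R)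
    (t : tangent_iso G g) (h : {vspace g}) (y : G) (l : hdual h) : hdual h :=
  linfun (fun X : subvs_of h =>
    (l : 'Hom(subvs_of h, R^o)) (vsproj h (Ad t y (vsval X)))).

(* d/dl^i: the i-th vector of the basis of h^* dual to the basis hb of h *)
Definition dual_vec (R : realType) (g : vectType R) (h : {vspace g})
    (hb : (\dim h).-tuple g) (i : 'I_(\dim h)) : hdual h :=
  linfun (fun X : subvs_of h => coord hb i (vsval X) : R^o).

Record triangular_dynamical_rmatrix (R : realType) (g : vectType R)
    (br : g -> g -> g) (h : {vspace g}) (G : lieGroupType R)
    (t : tangent_iso G g) (K : lieGroupType R) (iota : K -> G)
    (hb : (\dim h).-tuple g) (U : set (hdual h)) (r : hdual h -> ext g) : Prop :=
  TriangularDynamicalRMatrix {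
    tdr_bivector : forall l, U l -> r l \in ext_pow 2 (fullv : {vspace g});
    tdr_smooth : vsmooth_on U r;
    tdr_equivariant : forall (y : K) l,
      U l -> U (coAd t (iota y)^-1%g l) ->
      r (coAd t (iota y)^-1%g l) = ext_map (Ad t (iota y)) (r l);
    tdr_dybe : forall l, U l ->
      \sum_(i < \dim h) ext_wedge1 hb`_i (vderive r l (dual_vec hb i))
        - 2^-1 *: schouten br (r l) (r l) = 0
  }.

(* The bivector pi at (l, y) of U x G.  The tangent space at (l, y) is
   h^* x T_y G, where T_y G is read in the chart c at y; the left-invariant
   vector field of X in g has value T_1 L_y (X) at y. *)
Definition left_field (R : realType) (G : lieGroupType R) (g : vectType R)
    (t : tangent_iso G g) (c : chart R G (@mdim R G)) (y : G) (X : g) :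
    'rV[R]_(@mdim R G) :=
  tmap (ti_chart t) c (fun z : G => (y * z)%g : G) 1%g (t X).

Definition rmatrix_poisson (R : realType) (g : vectType R) (br : g -> g -> g)
    (h : {vspace g}) (G : lieGroupType R) (t : tangent_iso G g)
    (hb : (\dim h).-tuple g) (r : hdual h -> ext g)
    (l : hdual h) (c : chart R G (@mdim R G)) (y : G) :
    ext (hdual h * 'rV[R]_(@mdim R G))%type :=
  let dl i : hdual h * 'rV[R]_(@mdim R G) := (dual_vec hb i, 0) in
  let left X : hdual h * 'rV[R]_(@mdim R G) := (0, left_field t c y X) in
  2^-1 *: \sum_(i < \dim h) \sum_(j < \dim h)
      ((l : 'Hom(subvs_of h, R^o)) (vsproj h (br hb`_i hb`_j)) : R)
        *: ext_wedge [:: dl i; dl j]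
  + \sum_(i < \dim h) ext_wedge [:: dl i; left hb`_i]
  + ext_map left (r l).

Definition nondegenerate_bivector (R : realType) (V : vectType R) (w : ext V) :
    Prop :=
  forall xi : 'Hom(V, R^o), ext_contract xi w = 0 -> xi = 0.

Definition nondegenerate_rmatrix (R : realType) (g : vectType R)
    (br : g -> g -> g) (h : {vspace g}) (G : lieGroupType R)
    (t : tangent_iso G g) (hb : (\dim h).-tuple g) (U : set (hdual h))
    (r : hdual h -> ext g) : Prop :=
  forall l (y : G) c, U l -> atlas c -> cdom c y ->
    nondegenerate_bivector (rmatrix_poisson br t hb r l c y).

(* Main.v *)
From HB Require Import structures.
Require Import Defs.
From mathcomp Require Import all_boot all_order all_algebra.
From mathcomp Require Import all_classical all_reals all_analysis.
From mathcomp Require Import ring lra.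
Set Implicit Arguments.
Unset Strict Implicit.
Unset Printing Implicit Defensive.
Import Order.TTheory GRing.Theory Num.Theory.
Import numFieldNormedType.Exports VectorInternalTheory.
Local Open Scope classical_set_scope.
Local Open Scope ring_scope.

(** Fix l in U and let F be the fat form of l, a non-degenerate skew form on m.
    If E is the family of m dual to the basis e, then r l is half the sum of the
    e_i /\ E_i.  This tensor depends only on F, not on e, because it is the
    identity of m read through F ([fat_casimir_invariant]); everything is deduced
    from that.

    Equivariance.  The derivative of Ad along the subgroup consists of the brackets
    with elements of h, which preserve h and m.  Along a segment in a chart, Ad
    composed with the projection modulo such a subspace solves a linear
    differential equation with zero initial value, so it vanishes near the
    identity, and on the whole connected subgroup ([invariant_subspace]).  As each
    Ad_y is also a Lie algebra automorphism ([Ad_br]), it carries the fat form of l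
    to the one of the transported functional, dual families to dual families, and
    r to r ([fat_rmatrix_equivariant]).

    Dynamical equation.  One finds that [r, r] is the sum of the
    [e_i, e_k] /\ E_i /\ E_k.  The m-part of the brackets contributes zero: lowering
    its indices by F gives the cyclic sum of the F [e_i, e_k] e_p, which vanishes by
    the Jacobi identity ([fat_m_part_wedge]).  The derivative of the inverse matrix
    c of the matrix a of F in a direction v is - c (D_v a) c, and D_v a is the
    matrix of the fat form of v, since a is linear in l.  This turns the h-part into
    twice the sum of the h_i /\ D_i r ([fat_dybe]).  The coefficients of r are
    rational functions of l, which gives smoothness ([fat_rmatrix_smooth]).

    Non-degeneracy.  The bivector r inverts F on m, and the terms D_i /\ h_i pair
    h^* with the left-invariant fields of h, so a covector killed by the Poisson
    bivector vanishes in all directions ([poisson_nondegenerate]). *)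

(** * Linear and multilinear algebra *)

(** The facts of the theory of linear maps for a function that comes with a
    proof of linearity, such as one slot of a Lie bracket or of a form. *)
Section LinearPredicate.
Variables (R : pzRingType) (V W : lmodType R) (f : V -> W).
Hypothesis f_linear : linear f.

Let L : {linear V -> W} := HB.pack f (GRing.isLinear.Build _ _ _ _ f f_linear).

Lemma pred_linear_sumZ I (r : seq I) P (a : I -> R) (x : I -> V) :
  f (\sum_(i <- r | P i) a i *: x i) = \sum_(i <- r | P i) a i *: f (x i).
Proof.
by rewrite [LHS](linear_sum L); apply: eq_bigr => i _; exact: (linearZZ L).
Qed.

Lemma pred_linear0 : f 0 = 0. Proof. exact: (linear0 L). Qed.
Lemma pred_linearD x y : f (x + y) = f x + f y. Proof. exact: (linearD L). Qed.
Lemma pred_linearB x y : f (x - y) = f x - f y. Proof. exact: (linearB L). Qed.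
Lemma pred_linearN x : f (- x) = - f x. Proof. exact: (linearN L). Qed.

End LinearPredicate.

Lemma scaleR_true (R : realType) (a : R) : a *: (true%:R : R^o) = a.
Proof. exact: mulr1. Qed.

Lemma half_double (R : realType) (W : lmodType R) (w : W) : (2^-1 : R) *: (w + w) = w.
Proof. by rewrite scalerDr -scalerDl -[2^-1]mul1r -splitr scale1r. Qed.

Lemma big_cyclic3 (W : nmodType) n (G : 'I_n -> 'I_n -> 'I_n -> W) :
  \sum_(i < n) \sum_(k < n) \sum_(p < n) G i k p
  = \sum_(i < n) \sum_(k < n) \sum_(p < n) G k p i.
Proof.
rewrite [RHS]exchange_big /=; apply: eq_bigr => i _.
by rewrite exchange_big.
Qed.

Lemma scaleRE (R : realType) (a : R) (x : R^o) : a *: x = a * x.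
Proof. by []. Qed.

(** The two sign identities to which permuting two operators of the exterior
    algebra is reduced. *)
Lemma opposite_signs (R : comRingType) (a b c x y w : R) :
  a * b * x * (c * y * w) = - (- a * c * y * (b * x * w)).
Proof. ring. Qed.

Lemma cancel_signs (R : comRingType) (s a b x y w : R) : s * s = 1 ->
  s * (a * (x * (s * (b * (y * w))))) = b * (y * (a * (x * w))).
Proof.
move=> ss; transitivity ((s * s) * (b * (y * (a * (x * w))))); first by ring.
by rewrite ss mul1r.
Qed.

Lemma linearP_sub (R : pzRingType) (W : lmodType R) a (x y z w : W) :
  (a *: x + y) - (a *: z + w) = a *: (x - z) + (y - w).
Proof. by rewrite scalerBr opprD addrACA. Qed.

(** * The exterior algebra *)

Arguments ext_wedge : simpl never.

Section ExteriorAlgebra.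
Variables (R : realType) (V : vectType R).
Implicit Types (x y : V) (w u : ext V) (A : {set 'I_(dim V)}).

Let below (i : 'I_(dim V)) A := [set j in A | (j < i)%N]%SET.

(** The sign attached to i in A changes on removing j exactly when j < i; all
    sign rules of the exterior algebra come from this count. *)
Lemma card_belowD1 i j A : j \in A ->
  #|below i A| = ((j < i) + #|below i (A :\ j)%SET|)%N.
Proof.
move=> jA; rewrite (cardsD1 j) !inE jA; congr (_ + _)%N.
by apply: eq_card => k; rewrite !inE andbA.
Qed.

Lemma ext_wedge1_is_linearr x : linear (ext_wedge1 x : ext V -> ext V).
Proof.
move=> a u w; apply/ffunP => A; rewrite !ffunE scaler_sumr -big_split /=.
by apply: eq_bigr => i _; rewrite !ffunE !scaleRE mulrDr (mulrCA _ a).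
Qed.

Lemma ext_wedge1_is_linearl w : linear (fun x => ext_wedge1 x w : ext V).
Proof.
move=> a x y; apply/ffunP => A; rewrite !ffunE scaler_sumr -big_split /=.
by apply: eq_bigr => i _; rewrite linearP !mxE scaleRE mulrDr mulrDl (mulrCA _ a) -!mulrA.
Qed.

Lemma ext_contract_is_linear (xi : 'Hom(V, R^o)) :
  linear (ext_contract xi : ext V -> ext V).
Proof.
move=> a u w; apply/ffunP => A; rewrite !ffunE scaler_sumr -big_split /=.
by apply: eq_bigr => i _; rewrite !ffunE !scaleRE mulrDr (mulrCA _ a).
Qed.

HB.instance Definition _ x := GRing.isLinear.Build _ _ _ _ (ext_wedge1 x)
  (ext_wedge1_is_linearr x).
HB.instance Definition _ xi := GRing.isLinear.Build _ _ _ _ (@ext_contract R V xi)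
  (ext_contract_is_linear xi).

(** Exactly one of i < j and j < i holds, so removing first i then j, or first j
    then i, leads to opposite signs. *)
Lemma ext_wedge1C x y w :
  ext_wedge1 x (ext_wedge1 y w) = - ext_wedge1 y (ext_wedge1 x w).
Proof.
apply/ffunP => A; rewrite !ffunE -sumrN.
under eq_bigr do rewrite ffunE mulr_sumr.
under [RHS]eq_bigr do rewrite ffunE mulr_sumr -sumrN.
rewrite (exchange_big_dep (mem A)) /=; last first.
  by move=> i j _; rewrite !inE => /andP[].
apply: eq_bigr => i iA.
rewrite (eq_bigl (fun j => (j \in (A :\ i)%SET))); last first.
  by move=> j; rewrite !inE iA eq_sym; case: eqP; rewrite ?andbF ?andbT.
apply: eq_bigr => j; rewrite !inE => /andP[ji jA].
rewrite (card_belowD1 j iA) (card_belowD1 i jA).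
rewrite !finset.setDDl finset.setUC !exprD.
have : (-1 : R) ^+ (j < i)%N = - (-1 : R) ^+ (i < j)%N.
  by case: ltngtP ji => [|| /val_inj ->]; rewrite ?eqxx //= !expr0 ?expr1 ?opprK.
rewrite /below => ->; exact: opposite_signs.
Qed.

Lemma ext_wedge1xx x w : ext_wedge1 x (ext_wedge1 x w) = 0.
Proof.
have /eqP := ext_wedge1C x x w; rewrite -addr_eq0 -mulr2n -scaler_nat.
by rewrite scaler_eq0 pnatr_eq0 /= => /eqP.
Qed.

Lemma v2r_sum x : x = \sum_i v2r x 0 i *: r2v (delta_mx 0 i).
Proof.
apply: (can_inj (@v2rK R V)); rewrite linear_sum /= [LHS]row_sum_delta.
by apply: eq_bigr => i _; rewrite linearZ /= r2vK.
Qed.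

Lemma lfun_v2r (xi : 'Hom(V, R^o)) x :
  xi x = \sum_i v2r x 0 i * xi (r2v (delta_mx 0 i)).
Proof.
by rewrite {1}(v2r_sum x) linear_sum; apply: eq_bigr => i _; rewrite linearZ.
Qed.

(** Contraction inserts an index i and the wedge product removes an index j.
    The terms with i = j add up to [xi x *: w], over i outside A in one product
    and over i in A in the other; the terms with i <> j cancel, because
    exactly one of i < j and j < i holds. *)
Lemma ext_contract_wedge1 (xi : 'Hom(V, R^o)) x w :
  ext_contract xi (ext_wedge1 x w)
    = (xi x : R) *: w - ext_wedge1 x (ext_contract xi w).
Proof.
apply/ffunP => A; rewrite !ffunE scaleRE.
have E1 : \sum_(i | i \notin A) (-1) ^+ #|below i A| * xi (r2v (delta_mx 0 i))
       * ext_wedge1 x w (i |: A)%SET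
     = \sum_(i | i \notin A) v2r x 0 i * xi (r2v (delta_mx 0 i)) * w A
     + \sum_(i | i \notin A) \sum_(j in A) (-1) ^+ #|below i A|
        * xi (r2v (delta_mx 0 i)) * ((-1) ^+ #|below j (i |: A)%SET|
        * v2r x 0 j * w ((i |: A) :\ j)%SET).
  rewrite -big_split /=; apply: eq_bigr => i iA.
  rewrite ffunE (bigD1 i) ?setU11 //= finset.setU1K // mulrDr; congr (_ + _).
    rewrite (card_belowD1 _ (setU11 i A)) ltnn add0n finset.setU1K //.
    set s := _ ^+ _; have ss : s * s = 1 by rewrite /s -expr2 sqrr_sign.
    by rewrite mulrACA !mulrA ss mul1r.
  rewrite mulr_sumr; apply: eq_bigl => j; rewrite !inE.
  by case: eqVneq => [->|]; rewrite ?andbT ?(negPf iA) //= andbF.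
have E2 : \sum_(j in A) (-1) ^+ #|below j A| * v2r x 0 j *
          ext_contract xi w (A :\ j)%SET
     = \sum_(j in A) v2r x 0 j * xi (r2v (delta_mx 0 j)) * w A
     + \sum_(j in A) \sum_(i | i \notin A) (-1) ^+ #|below j A| * v2r x 0 j
        * ((-1) ^+ #|below i (A :\ j)%SET| * xi (r2v (delta_mx 0 i))
            * w (i |: (A :\ j))%SET).
  rewrite -big_split /=; apply: eq_bigr => j jA.
  rewrite ffunE (bigD1 j) ?setD11 //= finset.setD1K // mulrDr; congr (_ + _).
    rewrite (card_belowD1 _ jA) ltnn add0n.
    set s := _ ^+ _; have ss : s * s = 1 by rewrite /s -expr2 sqrr_sign.
    by rewrite mulrACA !mulrA ss mul1r (mulrC (xi _)).
  rewrite mulr_sumr; apply: eq_bigl => i; rewrite !inE.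
  by case: eqVneq => [->|]; rewrite ?andbT ?jA.
rewrite E1 {}E2 opprD addrA lfun_v2r mulr_suml [in RHS](bigID (mem A)) /=.
rewrite (addrC (\sum_(i in A) _)) addrK; congr (_ + _).
rewrite exchange_big /= -sumrN; apply: eq_bigr => j jA.
rewrite -sumrN; apply: eq_bigr => i iA.
have ij : i != j by apply: contraNneq iA => ->.
have -> : ((i |: A) :\ j = i |: (A :\ j))%SET.
  by apply/setP => k; rewrite !inE; case: eqVneq => // ->; rewrite eq_sym (negPf ij).
rewrite (card_belowD1 i jA) (card_belowD1 j (setU11 i A)) finset.setU1K //.
rewrite !exprD.
have -> : (-1 : R) ^+ (j < i)%N = - (-1 : R) ^+ (i < j)%N.
  by case: ltngtP ij => [|| /val_inj ->]; rewrite ?eqxx //= !expr0 ?expr1 ?opprK.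
set s1 := _ ^+ _; set s2 := _ ^+ _; set s3 := _ ^+ _.
rewrite -!mulrA !mulNr; congr (- _).
by apply: (cancel_signs (R := R)); rewrite /s1 -expr2 sqrr_sign.
Qed.

Definition wedge1l w : {linear V -> ext V} :=
  HB.pack (fun x => ext_wedge1 x w)
    (GRing.isLinear.Build _ _ _ _ (fun x => ext_wedge1 x w) (ext_wedge1_is_linearl w)).

Lemma ext_wedge1Dl w x y : ext_wedge1 (x + y) w = ext_wedge1 x w + ext_wedge1 y w.
Proof. exact: (linearD (wedge1l w)). Qed.

Lemma ext_wedge1Bl w x y : ext_wedge1 (x - y) w = ext_wedge1 x w - ext_wedge1 y w.
Proof. exact: (linearB (wedge1l w)). Qed.

Lemma ext_wedge1Nl w x : ext_wedge1 (- x) w = - ext_wedge1 x w.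
Proof. exact: (linearN (wedge1l w)). Qed.

Lemma ext_wedge1Zl w a x : ext_wedge1 (a *: x) w = a *: ext_wedge1 x w.
Proof. exact: (linearZZ (wedge1l w)). Qed.

Lemma ext_wedge1Pl w a x y :
  ext_wedge1 (a *: x + y) w = a *: ext_wedge1 x w + ext_wedge1 y w.
Proof. exact: (linearP (wedge1l w)). Qed.

Lemma ext_wedge1Pr x a u w :
  ext_wedge1 x (a *: u + w) = a *: ext_wedge1 x u + ext_wedge1 x w.
Proof. exact: linearP. Qed.

Lemma ext_wedge1Zr x a u : ext_wedge1 x (a *: u) = a *: ext_wedge1 x u.
Proof. exact: linearZ. Qed.

Lemma ext_wedge1_sumr x I (r : seq I) P (F : I -> ext V) :
  ext_wedge1 x (\sum_(i <- r | P i) F i) = \sum_(i <- r | P i) ext_wedge1 x (F i).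
Proof. exact: linear_sum. Qed.

Lemma ext_wedge1_suml w I (r : seq I) P (F : I -> V) :
  ext_wedge1 (\sum_(i <- r | P i) F i) w = \sum_(i <- r | P i) ext_wedge1 (F i) w.
Proof. exact: (linear_sum (wedge1l w)). Qed.

Lemma ext_wedge_cons x s : ext_wedge (x :: s) = ext_wedge1 x (ext_wedge s).
Proof. by []. Qed.

Lemma ext_wedge_vecE x i : ext_wedge [:: x] [set i]%SET = v2r x 0 i.
Proof.
rewrite /ext_wedge /= ffunE big_set1 ffunE finset.setDv eqxx mulr1.
rewrite (card_belowD1 _ (set11 i)) ltnn finset.setDv.
by rewrite eq_card0 ?mul1r // => j; rewrite !inE.
Qed.

Lemma ext_wedge_vec_eq0 x : ext_wedge [:: x] = 0 -> x = 0.
Proof.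
move=> x0; rewrite (v2r_sum x) big1 // => i _.
by rewrite -ext_wedge_vecE x0 ffunE scale0r.
Qed.

Lemma ext_contractZ xi a w : ext_contract xi (a *: w) = a *: ext_contract xi w.
Proof. exact: linearZ. Qed.

Lemma ext_contractD xi u w :
  ext_contract xi (u + w) = ext_contract xi u + ext_contract xi w.
Proof. exact: linearD. Qed.

Lemma ext_contract_sum xi I (r : seq I) P (F : I -> ext V) :
  ext_contract xi (\sum_(i <- r | P i) F i)
    = \sum_(i <- r | P i) ext_contract xi (F i).
Proof. exact: linear_sum. Qed.

Lemma ext_contract1 xi : ext_contract xi (ext1 V) = 0.
Proof.
apply/ffunP => A; rewrite !ffunE big1 // => i iA; rewrite ffunE.
suff -> : ((i |: A) == finset.set0)%SET = false by rewrite mulr0.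
by apply/negP => /eqP /setP /(_ i); rewrite !inE eqxx.
Qed.

Lemma ext_contract_wedge2 (xi : 'Hom(V, R^o)) x y :
  ext_contract xi (ext_wedge [:: x; y])
    = ext_wedge [:: (xi x : R) *: y - (xi y : R) *: x].
Proof.
rewrite !ext_wedge_cons /= !ext_contract_wedge1 ext_contract1 linear0 subr0.
by rewrite linearZ ext_wedge1Bl !ext_wedge1Zl.
Qed.

Lemma enum_set2 (n : nat) (i j : 'I_n) : (i < j)%N -> enum [set i; j]%SET = [:: i; j].
Proof.
move=> ij; apply: (@irr_sorted_eq _ (fun a b : 'I_n => (a < b)%N)).
- by move=> a b c; apply: ltn_trans.
- by move=> a; apply: ltnn.
- rewrite /enum_mem; apply: sorted_filter => [a b c|]; first exact: ltn_trans.
  by have := iota_ltn_sorted 0 n; rewrite -val_enum_ord sorted_map enumT.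
- by rewrite /= ij.
by move=> k; rewrite mem_enum !inE.
Qed.

Let b (i : 'I_(dim V)) : V := r2v (delta_mx 0 i).

Let v2r_b i k : v2r (b i) 0 k = (k == i)%:R.
Proof. by rewrite r2vK mxE eqxx. Qed.

Lemma ext_wedge1_b i w A : ext_wedge1 (b i) w A =
  if i \in A then (-1) ^+ #|below i A| * w (A :\ i)%SET else 0.
Proof.
rewrite ffunE; case: ifPn => iA.
  rewrite (bigD1 i) //= v2r_b eqxx mulr1 big1 ?addr0 // => k /andP[_ ki].
  by rewrite v2r_b (negPf ki) mulr0 mul0r.
rewrite big1 // => k kA; rewrite v2r_b; case: eqP => [ki|_].
  by rewrite -ki kA in iA.
by rewrite mulr0 mul0r.
Qed.

Lemma ext_wedge2_b (i j : 'I_(dim V)) A : (i < j)%N ->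
  ext_wedge [:: b i; b j] A = (A == [set i; j]%SET)%:R.
Proof.
move=> ij; have ji : (j == i) = false by apply/eqP => ji; rewrite ji ltnn in ij.
rewrite !ext_wedge_cons !ext_wedge1_b /= !inE ji /= ffunE.
case: (eqVneq A [set i; j]%SET) => [->|Aij].
  have -> : ([set i; j] :\ i)%SET = [set j]%SET.
    by rewrite finset.setU1K // inE eq_sym ji.
  rewrite !inE !eqxx finset.setDv eqxx.
  have -> : below i [set i; j]%SET = finset.set0.
    apply/setP => k; rewrite !inE; case: eqVneq => [->|_]; rewrite ?ltnn //=.
    by case: eqVneq => [->|]; rewrite // ltnNge ltnW.
  have -> : below j [set j]%SET = finset.set0.
    by apply/setP => k; rewrite !inE; case: eqVneq => [->|_]; rewrite ?ltnn.
  by rewrite cards0 orbT /= !expr0 !mulr1.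
case: ifP => // iA; case: ifP => [jA|]; last by rewrite mulr0.
suff -> : (A :\ i :\ j == finset.set0)%SET = false by rewrite !mulr0.
apply/negP => /eqP E; case/eqP: Aij; apply/setP => k.
move/setP/(_ k) : E; rewrite !inE.
by case: eqVneq => [->|_] /=; rewrite ?jA ?orbT //; case: eqVneq => [->|] //=; rewrite iA.
Qed.

(** The universal property of the second exterior power.  Only two-element sets
    contribute, so F matters only on lists of length 2.  Both [ext_map] and
    [schouten] are defined by expansion in the standard basis, and this evaluates
    them on arbitrary decomposable bivectors. *)
Lemma ext_wedge2_sum (W : lmodType R) (Phi : V -> V -> W) (F : seq V -> W) :
  (forall y, linear (Phi^~ y)) -> (forall x, linear (Phi x)) ->
  (forall x, Phi x x = 0) -> (forall x y, F [:: x; y] = Phi x y) ->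
  forall x y,
  \sum_(A : {set 'I_(dim V)}) (ext_wedge [:: x; y] A : R) *: F (ext_basis A) = Phi x y.
Proof.
move=> Phil Phir Phi0 FE.
pose PL y : {linear V -> W} :=
  HB.pack (Phi^~ y) (GRing.isLinear.Build _ _ _ _ (Phi^~ y) (Phil y)).
pose PR x : {linear V -> W} :=
  HB.pack (Phi x) (GRing.isLinear.Build _ _ _ _ (Phi x) (Phir x)).
have PhiC x y : Phi x y = - Phi y x.
  have := Phi0 (x + y); rewrite [LHS](linearD (PL (x + y))) /=.
  rewrite [Phi x _](linearD (PR x)) [Phi y _](linearD (PR y)) /= !Phi0 addr0 add0r.
  by move/eqP; rewrite addr_eq0 => /eqP.
pose L w := \sum_(A : {set 'I_(dim V)}) (w A : R) *: F (ext_basis A).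
have Lp : linear (L : ext V -> W).
  move=> a u w; rewrite /L scaler_sumr -big_split /=.
  by apply: eq_bigr => A _; rewrite !ffunE scalerDl scalerA.
pose LL : {linear ext V -> W} := HB.pack L (GRing.isLinear.Build _ _ _ _ L Lp).
have Lb i j : L (ext_wedge [:: b i; b j]) = Phi (b i) (b j).
  wlog ij : i j / (i <= j)%N.
    case: (leqP i j) => ij H; first exact: H.
    rewrite !ext_wedge_cons ext_wedge1C [LHS](linearN LL)
      -[LHS]/(- L (ext_wedge [:: b j; b i])).
    by rewrite H ?(ltnW ij) // -PhiC.
  case: (ltngtP i j) ij => // [ij _|/val_inj -> _]; last first.
    by rewrite Phi0 !ext_wedge_cons ext_wedge1xx [LHS](linear0 LL).
  rewrite /L (bigD1 [set i; j]%SET) //= ext_wedge2_b // eqxx scale1r.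
  rewrite /ext_basis enum_set2 //= FE big1 ?addr0 // => A Aij.
  by rewrite ext_wedge2_b // (negPf Aij) scale0r.
move=> x y; rewrite -/(L _) !ext_wedge_cons {1}(v2r_sum x) ext_wedge1_suml.
rewrite [LHS](linear_sum LL) [in RHS](v2r_sum x) [RHS](linear_sum (PL y)) /=.
apply: eq_bigr => i _.
rewrite ext_wedge1Zl [LHS](linearZZ LL) [RHS](linearZZ (PL y)) /=; congr (_ *: _).
rewrite {1}(v2r_sum y) ext_wedge1_suml linear_sum [LHS](linear_sum LL).
rewrite [in RHS](v2r_sum y) [RHS](linear_sum (PR _)) /=; apply: eq_bigr => j _.
rewrite ext_wedge1Zl linearZZ [LHS](linearZZ LL) [RHS](linearZZ (PR _)) /=.
by rewrite -Lb.
Qed.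

End ExteriorAlgebra.

(** * Bivectors under linear maps and the Schouten bracket *)

Section Functoriality.
Variables (R : realType).

Lemma ext_map_is_linear (V W : vectType R) (f : V -> W) :
  linear (ext_map f : ext V -> ext W).
Proof.
move=> a u w; rewrite /ext_map scaler_sumr -big_split /=.
by apply: eq_bigr => A _; rewrite !ffunE scalerDl scalerA.
Qed.

HB.instance Definition _ (V W : vectType R) (f : V -> W) :=
  GRing.isLinear.Build _ _ _ _ (@ext_map R V W f) (ext_map_is_linear f).

Lemma ext_mapZ (V W : vectType R) (f : V -> W) a w :
  ext_map f (a *: w) = a *: ext_map f w.
Proof. exact: linearZ. Qed.

Lemma ext_map_sum (V W : vectType R) (f : V -> W) I (r : seq I) P (F : I -> ext V) :
  ext_map f (\sum_(i <- r | P i) F i) = \sum_(i <- r | P i) ext_map f (F i).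
Proof. exact: linear_sum. Qed.

Lemma ext_map_wedge2 (V W : vectType R) (f : {linear V -> W}) x y :
  ext_map f (ext_wedge [:: x; y]) = ext_wedge [:: f x; f y].
Proof.
apply: (ext_wedge2_sum (Phi := fun x y => ext_wedge [:: f x; f y])
   (F := fun s => ext_wedge [seq f v | v <- s])) => //.
- by move=> z a u w; rewrite !ext_wedge_cons linearP ext_wedge1Pl.
- move=> z a u w; rewrite !ext_wedge_cons linearP ext_wedge1Pl.
  by rewrite linearP.
- by move=> z; rewrite !ext_wedge_cons ext_wedge1xx.
Qed.

Variables (g : vectType R) (br : g -> g -> g).
Hypothesis brl : forall y, linear (br^~ y).
Hypothesis brr : forall x, linear (br x).

Lemma schouten_is_linearr u : linear (schouten br u).
Proof.
move=> a v w; rewrite /schouten scaler_sumr -big_split /=.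
apply: eq_bigr => A _; rewrite scaler_sumr -big_split /=.
apply: eq_bigr => B _; rewrite !ffunE scalerA -scalerDl; congr (_ *: _).
by rewrite scaleRE mulrDr mulrCA.
Qed.

Lemma schouten_is_linearl w : linear (fun u => schouten br u w).
Proof.
move=> a v u; rewrite /schouten scaler_sumr -big_split /=.
apply: eq_bigr => A _; rewrite scaler_sumr -big_split /=.
apply: eq_bigr => B _; rewrite !ffunE scalerA -scalerDl; congr (_ *: _).
by rewrite scaleRE mulrDl mulrA.
Qed.

Lemma schouten_suml I (r : seq I) P (F : I -> ext g) w :
  schouten br (\sum_(i <- r | P i) F i) w = \sum_(i <- r | P i) schouten br (F i) w.
Proof.
exact: (linear_sum (HB.pack (fun u => schouten br u w) (GRing.isLinear.Build _ _ _ _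
  (fun u => schouten br u w) (schouten_is_linearl w)) : {linear ext g -> ext g})).
Qed.

Lemma schoutenZl a u w : schouten br (a *: u) w = a *: schouten br u w.
Proof.
exact: (linearZZ (HB.pack (fun u => schouten br u w) (GRing.isLinear.Build _ _ _ _
  (fun u => schouten br u w) (schouten_is_linearl w)) : {linear ext g -> ext g})).
Qed.

Lemma schouten_sumr I (r : seq I) P (F : I -> ext g) u :
  schouten br u (\sum_(i <- r | P i) F i) = \sum_(i <- r | P i) schouten br u (F i).
Proof.
exact: (linear_sum (HB.pack (schouten br u) (GRing.isLinear.Build _ _ _ _
  (schouten br u) (schouten_is_linearr u)) : {linear ext g -> ext g})).
Qed.

Lemma schoutenZr a u w : schouten br w (a *: u) = a *: schouten br w u.
Proof.
exact: (linearZZ (HB.pack (schouten br w) (GRing.isLinear.Build _ _ _ _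
  (schouten br w) (schouten_is_linearr w)) : {linear ext g -> ext g})).
Qed.

Let ext_wedge_rcons_is_linear (s : seq g) : linear (fun x => ext_wedge (s ++ [:: x])).
Proof.
move=> a x y; elim: s => [|z s IH]; last by rewrite !cat_cons !ext_wedge_cons IH linearP.
by rewrite !ext_wedge_cons ext_wedge1Pl.
Qed.

(** For a fixed first argument s this is visibly bilinear and alternating in x
    and y, which allows the universal property to be applied in the second
    argument before anything is known about s. *)
Lemma schouten_decomposable2r s x y :
  schouten_decomposable br s [:: x; y] =
  \sum_(i < size s) (-1) ^+ i *:
     (ext_wedge (br s`_i x :: seq_omit i s ++ [:: y])
      - ext_wedge (br s`_i y :: seq_omit i s ++ [:: x])).
Proof.
apply: eq_bigr => i _; rewrite !big_ord_recl big_ord0 /= addr0 addn0 scalerBr.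
by congr (_ + _); rewrite addn1 exprS mulN1r scaleNr.
Qed.

Lemma schouten_decomposable22 x y z t :
  schouten_decomposable br [:: x; y] [:: z; t] =
  ext_wedge [:: br x z; y; t] - ext_wedge [:: br x t; y; z]
  - (ext_wedge [:: br y z; x; t] - ext_wedge [:: br y t; x; z]).
Proof.
rewrite schouten_decomposable2r !big_ord_recl big_ord0 /= addr0.
by rewrite expr0 scale1r expr1 scaleN1r.
Qed.

Lemma schouten_wedge2 x y z t :
  schouten br (ext_wedge [:: x; y]) (ext_wedge [:: z; t]) =
  ext_wedge [:: br x z; y; t] - ext_wedge [:: br x t; y; z]
  - (ext_wedge [:: br y z; x; t] - ext_wedge [:: br y t; x; z]).
Proof.
rewrite -schouten_decomposable22 /schouten.
under eq_bigr => A _.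
  under eq_bigr do rewrite -scalerA.
  rewrite -scaler_sumr (ext_wedge2_sum (Phi := fun z t =>
     schouten_decomposable br (ext_basis A) [:: z; t])
     (F := schouten_decomposable br (ext_basis A))) //; first over.
  - move=> v a u w; rewrite !schouten_decomposable2r scaler_sumr -big_split /=.
    apply: eq_bigr => i _; rewrite !scalerA mulrC -scalerA -scalerDr; congr (_ *: _).
    rewrite !ext_wedge_cons brr ext_wedge1Pl.
    by rewrite (ext_wedge_rcons_is_linear _ a) ext_wedge1Pr linearP_sub.
  - move=> v a u w; rewrite !schouten_decomposable2r scaler_sumr -big_split /=.
    apply: eq_bigr => i _; rewrite !scalerA mulrC -scalerA -scalerDr; congr (_ *: _).
    rewrite !ext_wedge_cons brr ext_wedge1Pl.
    by rewrite (ext_wedge_rcons_is_linear _ a) ext_wedge1Pr linearP_sub.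
  - by move=> v; rewrite schouten_decomposable2r big1 // => i _; rewrite subrr scaler0.
apply: (ext_wedge2_sum (Phi := fun x y => schouten_decomposable br [:: x; y] [:: z; t])
   (F := fun s => schouten_decomposable br s [:: z; t])) => //.
- move=> v a u w; rewrite !schouten_decomposable22 !ext_wedge_cons !brl.
  by rewrite !ext_wedge1Pl !ext_wedge1Pr !linearP_sub.
- move=> v a u w; rewrite !schouten_decomposable22 !ext_wedge_cons !brl.
  by rewrite !ext_wedge1Pl !ext_wedge1Pr !linearP_sub.
- by move=> v; rewrite schouten_decomposable22 subrr.
Qed.

End Functoriality.

(** * Fat reductive decompositions *)

Section Reductive.
Variables (R : realType) (g : vectType R) (br : g -> g -> g).
Hypothesis g_lie : lie_bracket br.
Variables (h m : {vspace g}).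
Hypothesis hm : reductive br h m.

Let brl := lie_linearl g_lie.
Let brr := lie_linearr g_lie.

Lemma lie_antisym x y : br x y = - br y x.
Proof.
have := lie_alt g_lie (x + y).
rewrite (pred_linearD (brl _)) !(pred_linearD (brr _)) !(lie_alt g_lie) addr0 add0r.
by move/eqP; rewrite addr_eq0 => /eqP.
Qed.

Lemma h_part_is_linear : linear (h_part h m).
Proof. by move=> a x y; rewrite /h_part !linearP. Qed.

Lemma val_h_part X : vsval (h_part h m X) = daddv_pi h m X.
Proof. by rewrite vsprojK // memv_pi. Qed.

Lemma h_part_add X : vsval (h_part h m X) + daddv_pi m h X = X.
Proof.
rewrite val_h_part daddv_pi_add // ?(reductive_direct hm) //.
by rewrite (reductive_sum hm) memvf.
Qed.

Lemma m_part_id X : X \in m -> daddv_pi m h X = X.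
Proof. by apply: daddv_pi_id; rewrite capvC (reductive_direct hm). Qed.

Lemma h_part_eq0 X : X \in m -> h_part h m X = 0.
Proof.
move=> Xm; apply: val_inj => /=; apply: (addIr X).
by have := h_part_add X; rewrite (m_part_id Xm) => ->; rewrite add0r.
Qed.

Lemma h_part_id X : X \in h -> vsval (h_part h m X) = X.
Proof.
by move=> Xh; rewrite val_h_part daddv_pi_id // (reductive_direct hm).
Qed.

Variable l : hdual h.
Local Notation F := (fat_form br m l).

Lemma fat_form_linearl Y : linear (fun X => F X Y : R^o).
Proof. by move=> a x y; rewrite /fat_form brl h_part_is_linear linearP. Qed.

Lemma fat_form_linearr X : linear (F X : g -> R^o).
Proof. by move=> a x y; rewrite /fat_form brr h_part_is_linear linearP. Qed.

Lemma fat_form_antisym X Y : F X Y = - F Y X.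
Proof. by rewrite /fat_form lie_antisym (pred_linearN h_part_is_linear) linearN. Qed.

Lemma fat_form_hm X Y : X \in h -> Y \in m -> F X Y = 0.
Proof.
by move=> Xh Ym; rewrite /fat_form h_part_eq0 ?linear0 // (reductive_invariant hm).
Qed.

(** The h-part of [X, Y] does not contribute, since [h, m] lies in m. *)
Lemma fat_form_m_part X Y Z : Z \in m ->
  F (daddv_pi m h (br X Y)) Z = F (br X Y) Z.
Proof.
move=> Zm; rewrite -{2}(h_part_add (br X Y)) [RHS](pred_linearD (fat_form_linearl Z)).
by rewrite [X in _ = X + _]fat_form_hm ?add0r //; exact: subvsP.
Qed.

(** The Jacobi identity: this is the closedness of the fat form. *)
Lemma fat_form_cyclic X Y Z :
  F (br X Y) Z + F (br Y Z) X + F (br Z X) Y = 0.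
Proof.
have lD u v : (l : 'Hom(subvs_of h, R^o)) (h_part h m u)
      + (l : 'Hom(subvs_of h, R^o)) (h_part h m v)
    = (l : 'Hom(subvs_of h, R^o)) (h_part h m (u + v)).
  by rewrite (pred_linearD h_part_is_linear) linearD.
rewrite /fat_form !lD (lie_antisym (br X Y)) (lie_antisym (br Y Z)) (lie_antisym (br Z X)).
rewrite -!opprD -addrA addrC (lie_jacobi g_lie).
by rewrite oppr0 (pred_linear0 h_part_is_linear) linear0.
Qed.

Hypothesis l_fat : forall X, X \in m -> (forall Y, Y \in m -> F X Y = 0) -> X = 0.
Variable e : (\dim m).-tuple g.
Hypothesis e_basis : basis_of m e.

Let a := \matrix_(i, j) F e`_i e`_j : 'M[R]_(\dim m).
Let c := invmx a.

(** The family of m dual to e with respect to the fat form: F (E i) e_k is the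
    Kronecker symbol. *)
Definition fat_dual (i : 'I_(\dim m)) : g := \sum_j c i j *: e`_j.
Local Notation E := fat_dual.

Let e_mem (i : 'I_(\dim m)) : e`_i \in m.
Proof. by apply: (basis_mem e_basis); rewrite mem_nth ?size_tuple. Qed.

Lemma fat_dual_mem i : E i \in m.
Proof. by apply: memv_suml => j _; apply: memvZ. Qed.

Lemma basis_expand X : X \in m -> X = \sum_(i < \dim m) coord e i X *: e`_i.
Proof. by move=> Xm; apply: coord_span; rewrite (span_basis e_basis). Qed.

(** A vector of the left kernel of the matrix is the coordinate vector of an
    element of m orthogonal to m. *)
Lemma fat_unitmx : a \in unitmx.
Proof.
rewrite unitmxE unitfE; apply/det0P => -[v v0 va].
have X0 : \sum_i v 0 i *: e`_i = 0.
  apply: l_fat => [|Y Ym]; first by apply: memv_suml => j _; apply: memvZ.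
  rewrite (basis_expand Ym) (pred_linear_sumZ (fat_form_linearr _)) big1 // => j _.
  rewrite (pred_linear_sumZ (fat_form_linearl _)).
  have /rowP/(_ j) := va; rewrite !mxE => va0.
  rewrite [X in _ *: X](_ : _ = 0) ?scaler0 //; apply: etrans va0.
  by apply: eq_bigr => i _; rewrite mxE.
case/eqP: v0; apply/rowP => i; rewrite mxE.
by have /freeP/(_ (v 0) X0) := basis_free e_basis; apply.
Qed.

Lemma fat_dualP (i k : 'I_(\dim m)) : F (E i) e`_k = (i == k)%:R.
Proof.
rewrite (pred_linear_sumZ (fat_form_linearl _)).
have /matrixP/(_ i k) := mulVmx fat_unitmx; rewrite !mxE => <-.
by apply: eq_bigr => j _; rewrite mxE.
Qed.

Lemma fat_dual_expand X : X \in m -> X = \sum_(k < \dim m) F X e`_k *: E k.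
Proof.
move=> Xm; apply/eqP; rewrite -subr_eq0; apply/eqP; apply: l_fat => [|Y Ym].
  by rewrite memvB // memv_suml // => i _; rewrite memvZ // fat_dual_mem.
rewrite (basis_expand Ym) (pred_linear_sumZ (fat_form_linearr _)) big1 // => j _.
rewrite [X in _ *: X](pred_linearB (fat_form_linearl _)).
rewrite (pred_linear_sumZ (fat_form_linearl _)) (bigD1 j) //= big1 => [|i ij].
  by rewrite fat_dualP eqxx addr0 scaleR_true subrr scaler0.
by rewrite fat_dualP (negPf ij) scaler0.
Qed.

Lemma fat_basis_expand Y : Y \in m -> Y = \sum_(k < \dim m) F (E k) Y *: e`_k.
Proof.
move=> Ym; rewrite {1}(basis_expand Ym); apply: eq_bigr => i _; congr (_ *: _).
rewrite {2}(basis_expand Ym) (pred_linear_sumZ (fat_form_linearr _)).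
rewrite (bigD1 i) //= big1 ?addr0 => [|j ji]; first by rewrite fat_dualP eqxx scaleR_true.
by rewrite fat_dualP eq_sym (negPf ji) scaler0.
Qed.

(** The tensor sum of the e_i (x) E_i represents the identity of m through the
    form, so it can be computed from any pair of dual families.  With various B
    this gives the skew symmetry of r, its contractions and its equivariance. *)
Lemma fat_casimir_invariant (W : lmodType R) (B : g -> g -> W) n (f f' : 'I_n -> g) :
  (forall y, linear (B^~ y)) -> (forall x, linear (B x)) ->
  (forall i, f i \in m) -> (forall X, X \in m -> X = \sum_i F X (f i) *: f' i) ->
  \sum_i B (f i) (f' i) = \sum_(i < \dim m) B e`_i (E i).
Proof.
move=> Bl Br fm fE.
under eq_bigr => i _ do
  rewrite [X in B X]fat_basis_expand ?fm // (pred_linear_sumZ (Bl _)).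
rewrite exchange_big /=; apply: eq_bigr => k _.
by rewrite [in RHS](fE (E k)) ?fat_dual_mem // (pred_linear_sumZ (Br _)).
Qed.

(** As the form is skew, the families E and - e are dual to each other too. *)
Lemma fat_casimir_swap (W : lmodType R) (B : g -> g -> W) :
  (forall y, linear (B^~ y)) -> (forall x, linear (B x)) ->
  \sum_(i < \dim m) B (E i) e`_i = - \sum_(i < \dim m) B e`_i (E i).
Proof.
move=> Bl Br.
rewrite -(@fat_casimir_invariant _ B _ E (fun i => - e`_i)) //.
- by rewrite -sumrN; apply: eq_bigr => i _; rewrite (pred_linearN (Br _)) opprK.
- exact: fat_dual_mem.
move=> X Xm; rewrite {1}(fat_basis_expand Xm); apply: eq_bigr => i _.
by rewrite (fat_form_antisym X) scalerN scaleNr opprK.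
Qed.

Lemma fat_rmatrixE :
  fat_rmatrix br e l = 2^-1 *: \sum_(i < \dim m) ext_wedge [:: e`_i; E i].
Proof.
congr (_ *: _); apply: eq_bigr => i _; rewrite !ext_wedge_cons ext_wedge1_suml.
by rewrite linear_sum; apply: eq_bigr => j _; rewrite ext_wedge1Zl linearZ.
Qed.

(** The bivector r, seen as a map from covectors to vectors, is the inverse of
    the fat form. *)
Lemma fat_rmatrix_contract (V : vectType R) (f : {linear g -> V}) (xi : 'Hom(V, R^o)) :
  ext_contract xi (ext_map f (fat_rmatrix br e l))
  = ext_wedge [:: f (\sum_(i < \dim m) (xi (f e`_i) : R) *: E i)].
Proof.
rewrite fat_rmatrixE ext_mapZ ext_contractZ ext_map_sum ext_contract_sum.
under eq_bigr do rewrite ext_map_wedge2 ext_contract_wedge2 ext_wedge_cons ext_wedge1Bl.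
rewrite sumrB -!ext_wedge1_suml.
have := @fat_casimir_swap _ (fun x y => (xi (f x) : R) *: f y).
move=> ->; last 2 first.
- by move=> y b u w; rewrite !linearP scalerDl -scalerA.
- by move=> x b u w; rewrite linearP scalerDr !scalerA mulrC.
rewrite ext_wedge1Nl opprK half_double linear_sum; congr ext_wedge1.
by apply: eq_bigr => i _; rewrite linearZ.
Qed.

(** The four terms of the bracket of two decomposable bivectors contribute
    equally, by exchanging e and E in one or both of the factors; this cancels
    the two coefficients 1/2 of r. *)
Lemma schouten_fat_rmatrix :
  schouten br (fat_rmatrix br e l) (fat_rmatrix br e l) =
  \sum_(i < \dim m) \sum_(k < \dim m) ext_wedge [:: br e`_i e`_k; E i; E k].
Proof.
pose T x y z t := ext_wedge [:: br x z; y; t].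
have Tl1 y z t : linear (fun x => T x y z t).
  by move=> b u w; rewrite /T brl !ext_wedge_cons ext_wedge1Pl.
have Tl2 x z t : linear (fun y => T x y z t).
  by move=> b u w; rewrite /T !ext_wedge_cons ext_wedge1Pl ext_wedge1Pr.
have Tl3 x y t : linear (fun z => T x y z t).
  by move=> b u w; rewrite /T brr !ext_wedge_cons ext_wedge1Pl.
have Tl4 x y z : linear (fun t => T x y z t).
  by move=> b u w; rewrite /T !ext_wedge_cons ext_wedge1Pl !ext_wedge1Pr.
have swap2 x y : \sum_(k < \dim m) T x y (E k) e`_k = - \sum_(k < \dim m) T x y e`_k (E k).
  by apply: (fat_casimir_swap (B := T x y)) => *; [exact: Tl3|exact: Tl4].
have swap1 z t : \sum_(k < \dim m) T (E k) e`_k z t = - \sum_(k < \dim m) T e`_k (E k) z t.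
  by apply: (fat_casimir_swap (B := fun x y => T x y z t)) => *; [exact: Tl1|exact: Tl2].
rewrite fat_rmatrixE schoutenZr schoutenZl schouten_suml.
under eq_bigr => i _.
  rewrite schouten_sumr.
  under eq_bigr => k _ do rewrite (schouten_wedge2 brl brr) -!/(T _ _ _ _).
  rewrite !sumrB !swap2 !opprK; over.
pose P := \sum_(i < \dim m) \sum_(k < \dim m) T e`_i (E i) e`_k (E k).
rewrite sumrB !big_split /= [X in _ - X](_ : _ = - P - P).
  by rewrite opprD !opprK !half_double.
have Q : \sum_(i < \dim m) \sum_(k < \dim m) T (E i) e`_i e`_k (E k) = - P.
  rewrite exchange_big /P [X in - X]exchange_big -sumrN.
  by apply: eq_bigr => k _; rewrite swap1.
by rewrite Q.
Qed.

(** Expanding the first factor in the family E gives the coefficients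
    F [e_i, e_k] e_p.  Their cyclic sum vanishes by the Jacobi identity while the
    wedge product of E_i, E_k and E_p is invariant under cyclic permutations, so
    three times the sum is zero. *)
Lemma fat_m_part_wedge :
  \sum_(i < \dim m) \sum_(k < \dim m)
    ext_wedge [:: daddv_pi m h (br e`_i e`_k); E i; E k] = 0.
Proof.
pose f (i k p : 'I_(\dim m)) := F (br e`_i e`_k) e`_p.
pose w (i k p : 'I_(\dim m)) := ext_wedge [:: E i; E k; E p].
have wC i k p : w p i k = w i k p.
  rewrite /w !ext_wedge_cons ext_wedge1C -linearN; congr (ext_wedge1 _ _).
  by rewrite ext_wedge1C opprK.
pose S := \sum_(i < \dim m) \sum_(k < \dim m) \sum_(p < \dim m) f i k p *: w i k p.
have S1 : S = \sum_(i < \dim m) \sum_(k < \dim m) \sum_(p < \dim m) f k p i *: w i k p.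
  rewrite /S big_cyclic3; do 3!(apply: eq_bigr => ? _); by rewrite -wC.
have S2 : S = \sum_(i < \dim m) \sum_(k < \dim m) \sum_(p < \dim m) f p i k *: w i k p.
  rewrite S1 big_cyclic3; do 3!(apply: eq_bigr => ? _); by rewrite -wC.
transitivity S.
  apply: eq_bigr => i _; apply: eq_bigr => k _.
  rewrite (fat_dual_expand (memv_pi _ _ _)) !ext_wedge_cons ext_wedge1_suml.
  apply: eq_bigr => p _; rewrite ext_wedge1Zl fat_form_m_part //.
  by rewrite -!ext_wedge_cons -/(w p i k) wC.
have : S + S + S = 0.
  rewrite {2}S1 {2}S2 -!big_split big1 // => i _.
  rewrite -!big_split big1 // => k _; rewrite -!big_split big1 //= => p _.
  by rewrite -!scalerDl /f fat_form_cyclic scale0r.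
by rewrite -mulr2n -mulrSr -scaler_nat => /eqP; rewrite scaler_eq0 pnatr_eq0 => /eqP.
Qed.

(** The derivative - c a' c of an inverse matrix, expressed in the dual family:
    as c is skew, - c a' c is the congruence of a' by c. *)
Lemma fat_rmatrix_variation (l' : hdual h) :
  let a' := \matrix_(i, j) fat_form br m l' e`_i e`_j in
  2^-1 *: \sum_(i < \dim m) \sum_(j < \dim m)
     (- (c *m a' *m c)) i j *: ext_wedge [:: e`_i; e`_j]
  = 2^-1 *: \sum_(i < \dim m) \sum_(j < \dim m)
     fat_form br m l' e`_i e`_j *: ext_wedge [:: E i; E j].
Proof.
move=> a'; congr (_ *: _).
have cT : c^T = - c.
  have aT : a^T = - a by apply/matrixP => i j; rewrite !mxE fat_form_antisym.
  apply: (can_inj (mulmxK fat_unitmx)).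
  rewrite mulNmx mulVmx ?fat_unitmx // -[a]opprK -aT mulmxN -trmx_mul.
  by rewrite mulmxV ?fat_unitmx // trmx1.
have -> : - (c *m a' *m c) = c^T *m a' *m c by rewrite cT !mulNmx.
transitivity (\sum_(i < \dim m) \sum_(j < \dim m) \sum_(p < \dim m) \sum_(q < \dim m)
   (c p i * a' p q * c q j) *: ext_wedge [:: e`_i; e`_j]).
  apply: eq_bigr => i _; apply: eq_bigr => j _.
  rewrite mxE; under eq_bigr do rewrite mxE mulr_suml.
  rewrite exchange_big /= scaler_suml; apply: eq_bigr => p _.
  by rewrite scaler_suml; apply: eq_bigr => q _; rewrite mxE.
transitivity (\sum_(p < \dim m) \sum_(q < \dim m) \sum_(i < \dim m) \sum_(j < \dim m)
   (c p i * a' p q * c q j) *: ext_wedge [:: e`_i; e`_j]).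
  under eq_bigr do rewrite exchange_big /=.
  rewrite exchange_big /=; apply: eq_bigr => p _.
  under eq_bigr do rewrite exchange_big /=.
  by rewrite exchange_big.
apply: eq_bigr => p _; apply: eq_bigr => q _.
rewrite !ext_wedge_cons ext_wedge1_suml scaler_sumr; apply: eq_bigr => i _.
rewrite ext_wedge1_suml ext_wedge1_sumr scaler_sumr; apply: eq_bigr => j _.
rewrite !ext_wedge1Zl ext_wedge1Zr !scalerA /a' mxE; congr (_ *: _).
by rewrite (mulrC (c p i)).
Qed.

End Reductive.

(** * Membership, equivariance and the dynamical Yang-Baxter equation *)

Lemma ext_pow2_mem (R : realType) (V : vectType R) (W : {vspace V}) x y :
  x \in W -> y \in W -> ext_wedge [:: x; y] \in ext_pow 2 W.
Proof.
move=> xW yW; rewrite (coord_vbasis xW) (coord_vbasis yW) !ext_wedge_cons.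
rewrite ext_wedge1_suml memv_suml // => i _; rewrite ext_wedge1_suml ext_wedge1_sumr.
rewrite memv_suml // => j _; rewrite !ext_wedge1Zl ext_wedge1Zr !memvZ //.
apply: memv_span; apply/mapP; exists [tuple i; j] => //=.
by rewrite mem_enum.
Qed.

Lemma fat_rmatrix_mem (R : realType) (g : vectType R) (br : g -> g -> g)
  (h m W : {vspace g}) (e : (\dim m).-tuple g) (l : hdual h) :
  {subset e <= W} -> fat_rmatrix br e l \in ext_pow 2 W.
Proof.
move=> eW; apply: memvZ; apply: memv_suml => i _; apply: memv_suml => j _.
by apply/memvZ/ext_pow2_mem; apply: eW; rewrite mem_nth ?size_tuple.
Qed.

Section Equivariance.
Variables (R : realType) (g : vectType R) (br : g -> g -> g).
Hypothesis g_lie : lie_bracket br.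
Variables (h m : {vspace g}).
Hypothesis hm : reductive br h m.
Variable e : (\dim m).-tuple g.
Hypothesis e_basis : basis_of m e.

Let fat (l : hdual h) :=
  forall X, X \in m -> (forall Y, Y \in m -> fat_form br m l X Y = 0) -> X = 0.

(** A transports the dual families e, E of l to dual families A e, A E of l', and
    r does not depend on the choice of dual families. *)
Lemma fat_rmatrix_equivariant (l l' : hdual h) (A A' : {linear g -> g}) :
  fat l -> fat l' -> (forall X, X \in m -> A X \in m) ->
  (forall X, X \in m -> A' X \in m) -> cancel A' A ->
  {in m &, forall X Y, fat_form br m l' (A X) (A Y) = fat_form br m l X Y} ->
  fat_rmatrix br e l' = ext_map A (fat_rmatrix br e l).
Proof.
move=> lf l'f Am A'm AK FA; rewrite !(fat_rmatrixE br) ext_mapZ ext_map_sum.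
congr (_ *: _); under [RHS]eq_bigr do rewrite ext_map_wedge2.
have e_mem (i : 'I_(\dim m)) : e`_i \in m.
  by apply: (basis_mem e_basis); rewrite mem_nth ?size_tuple.
rewrite -(fat_casimir_invariant g_lie l'f e_basis (B := fun x y => ext_wedge [:: x; y])
   (f := fun i => A e`_i) (f' := fun i => A (fat_dual br l e i))) //.
- by move=> y b u w; rewrite !ext_wedge_cons ext_wedge1Pl.
- by move=> x b u w; rewrite !ext_wedge_cons ext_wedge1Pl ext_wedge1Pr.
- by move=> i; apply: Am.
move=> X Xm; rewrite -{1}(AK X) {1}(fat_dual_expand g_lie lf e_basis (A'm _ Xm)).
by rewrite linear_sum; apply: eq_bigr => i _; rewrite linearZ -FA ?A'm // AK.
Qed.

Lemma dual_vecE (hb : (\dim h).-tuple g) p (Z : subvs_of h) :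
  (dual_vec hb p : 'Hom(subvs_of h, R^o)) Z = coord hb p (vsval Z).
Proof.
have L : linear (fun X : subvs_of h => coord hb p (vsval X) : R^o).
  by move=> b u w; rewrite !linearP.
exact: (lfunE (HB.pack (fun X : subvs_of h => coord hb p (vsval X) : R^o)
  (GRing.isLinear.Build _ _ _ _ (fun X : subvs_of h => coord hb p (vsval X) : R^o) L)
  : {linear subvs_of h -> R^o})).
Qed.

(** Split [e_i, e_k] in the formula for [r, r] along h and m.  The m-part
    contributes nothing.  The h-part, written in the basis hb, has the fat forms
    of the dual basis as coefficients, and these are the partial derivatives of
    the matrix of the fat form. *)
Lemma fat_dybe (hb : (\dim h).-tuple g) (l : hdual h) (D : 'I_(\dim h) -> ext g) :
  basis_of h hb -> fat l ->
  let c := invmx (\matrix_(i, j) fat_form br m l e`_i e`_j) in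
  (forall p, D p = 2^-1 *: \sum_(i < \dim m) \sum_(j < \dim m)
     (- (c *m (\matrix_(i, j) fat_form br m (dual_vec hb p) e`_i e`_j) *m c)) i j
       *: ext_wedge [:: e`_i; e`_j]) ->
  \sum_(p < \dim h) ext_wedge1 hb`_p (D p)
    - 2^-1 *: schouten br (fat_rmatrix br e l) (fat_rmatrix br e l) = 0.
Proof.
move=> hbP lf c DE.
under eq_bigr do rewrite DE (fat_rmatrix_variation g_lie lf e_basis) ext_wedge1Zr.
rewrite (schouten_fat_rmatrix g_lie lf e_basis) -scaler_sumr.
apply/eqP; rewrite -scalerBr scaler_eq0 subr_eq0; apply/orP; right; apply/eqP.
rewrite -[RHS]subr0 -[X in _ - X](fat_m_part_wedge g_lie hm lf e_basis) -sumrB.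
under eq_bigr => p _ do rewrite (ext_wedge1_sumr hb`_p).
rewrite exchange_big; apply: eq_bigr => i _ /=; rewrite -sumrB.
under eq_bigr => p _ do rewrite (ext_wedge1_sumr hb`_p).
rewrite exchange_big; apply: eq_bigr => k _ /=.
rewrite !ext_wedge_cons -ext_wedge1Bl -{1}(h_part_add hm (br e`_i e`_k)) addrK.
set Z := h_part h m _.
rewrite (coord_span (X := hb) (v := vsval Z)); last first.
  by rewrite (span_basis hbP); exact: subvsP.
rewrite [RHS]ext_wedge1_suml; apply: eq_bigr => p _; rewrite ext_wedge1Zl ext_wedge1Zr.
by rewrite /fat_form dual_vecE.
Qed.

End Equivariance.

(** * Non-degeneracy of the Poisson bivector *)

Section Nondegeneracy.
Variables (R : realType) (g : vectType R) (br : g -> g -> g).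
Hypothesis g_lie : lie_bracket br.
Variables (h m : {vspace g}).
Hypothesis hm : reductive br h m.
Variable e : (\dim m).-tuple g.
Hypothesis e_basis : basis_of m e.
Variable hb : (\dim h).-tuple g.
Hypothesis hb_basis : basis_of h hb.
Variable l : hdual h.
Hypothesis l_fat : forall X, X \in m -> (forall Y, Y \in m -> fat_form br m l X Y = 0) -> X = 0.

Let e_mem (i : 'I_(\dim m)) : e`_i \in m.
Proof. by apply: (basis_mem e_basis); rewrite mem_nth ?size_tuple. Qed.
Let hb_mem (i : 'I_(\dim h)) : hb`_i \in h.
Proof. by apply: (basis_mem hb_basis); rewrite mem_nth ?size_tuple. Qed.

Lemma reductive_eq0 u v : u \in h -> v \in m -> u + v = 0 -> u = 0 /\ v = 0.
Proof.
move=> uh vm /eqP; rewrite addr_eq0 => /eqP uv.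
have u0 : u = 0.
  apply/eqP; rewrite -memv0 -(reductive_direct hm) memv_cap uh /=.
  by rewrite uv memvN.
by split=> //; apply/eqP; rewrite -oppr_eq0 -uv u0.
Qed.

Lemma dual_vec_free (x : 'I_(\dim h) -> R) :
  \sum_(i < \dim h) x i *: dual_vec hb i = 0 -> forall i, x i = 0.
Proof.
move=> x0 k; have := congr1 (fun f : 'Hom(subvs_of h, R^o) => f (vsproj h hb`_k)) x0.
rewrite /= sum_lfunE (bigD1 k) //= big1 => [|i ik].
  rewrite scale_lfunE dual_vecE vsprojK // coord_free ?(basis_free hb_basis) // eqxx.
  by rewrite scaleR_true addr0 lfunE.
rewrite scale_lfunE dual_vecE vsprojK // coord_free ?(basis_free hb_basis) //.
by rewrite eq_sym (negPf ik) scaler0.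
Qed.

Lemma dual_vec_expand (x : hdual h) :
  x = \sum_(i < \dim h) (x : 'Hom(subvs_of h, R^o)) (vsproj h hb`_i) *: dual_vec hb i.
Proof.
apply/lfunP => Z; rewrite sum_lfunE.
have ZE : Z = \sum_(i < \dim h) coord hb i (vsval Z) *: vsproj h hb`_i.
  apply: val_inj; rewrite linear_sum /=.
  rewrite {1}(coord_span (X := hb) (v := vsval Z)); last first.
    by rewrite (span_basis hb_basis); exact: subvsP.
  by apply: eq_bigr => i _; rewrite vsprojK.
rewrite {1}ZE linear_sum; apply: eq_bigr => i _.
by rewrite linearZ scale_lfunE dual_vecE; exact: mulrC.
Qed.

Variables (T : vectType R) (L : {linear g -> T}).
Hypothesis L_bij : bijective L.

Let dl i : (hdual h * T)%type := (dual_vec hb i, 0).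
Let left X : (hdual h * T)%type := (0, L X).

Lemma left_is_linear : linear left.
Proof.
by move=> b X Y; rewrite /left linearP; congr (_, _); rewrite /= scaler0 addr0.
Qed.

(** Let the contraction by xi vanish.  Its component along T is the image by L of
    the sum of the xi (dl i) hb_i, which lies in h, and of the xi (left e_i) E_i,
    which lies in m; both vanish, hence so do their coefficients.  What remains
    along h^* is the sum of the - xi (left hb_i) dl i, so the xi (left hb_i)
    vanish too.  The vectors dl i, left hb_i and left e_i span the space. *)
Lemma poisson_nondegenerate (a : 'I_(\dim h) -> 'I_(\dim h) -> R) :
  nondegenerate_bivector
    (2^-1 *: \sum_(i < \dim h) \sum_(j < \dim h) a i j *: ext_wedge [:: dl i; dl j]
     + \sum_(i < \dim h) ext_wedge [:: dl i; left hb`_i]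
     + ext_map left (fat_rmatrix br e l)).
Proof.
move=> xi.
pose LL : {linear g -> (hdual h * T)%type} :=
  HB.pack left (GRing.isLinear.Build _ _ _ _ left left_is_linear).
rewrite !ext_contractD ext_contractZ.
rewrite [ext_contract xi (ext_map left _)](fat_rmatrix_contract g_lie l_fat e_basis LL).
rewrite !ext_contract_sum.
under eq_bigr => i _.
  rewrite ext_contract_sum.
  under eq_bigr => j _.
    rewrite ext_contractZ ext_contract_wedge2 ext_wedge_cons -ext_wedge1Zl; over.
  rewrite -ext_wedge1_suml; over.
rewrite -ext_wedge1_suml -ext_wedge1Zl.
under [X in _ + X + _]eq_bigr do rewrite ext_contract_wedge2 ext_wedge_cons.
rewrite -ext_wedge1_suml -!ext_wedge1Dl -ext_wedge_cons => /ext_wedge_vec_eq0.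
set Z1 := _ *: _; set Z2 := \sum_(i < _) _; set Z3 := LL _ => Z0.
have Z1snd : Z1.2 = 0.
  rewrite /Z1 /= raddf_sum big1 ?scaler0 // => i _ /=.
  by rewrite raddf_sum big1 // => j _ /=; rewrite !scaler0 subr0 scaler0.
pose x i := xi (dl i) : R; pose y (i : 'I_(\dim m)) := xi (left e`_i) : R.
have Z2snd : Z2.2 = L (\sum_(i < \dim h) x i *: hb`_i).
  rewrite /Z2 raddf_sum linear_sum; apply: eq_bigr => i _ /=.
  by rewrite scaler0 subr0 linearZ.
have [|||u0 v0] := @reductive_eq0 (\sum_(i < \dim h) x i *: hb`_i)
    (\sum_(i < \dim m) y i *: fat_dual br l e i).
- by apply: memv_suml => i _; apply: memvZ.
- by apply: memv_suml => i _; apply/memvZ/fat_dual_mem.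
- apply: (bij_inj L_bij); rewrite linearD linear0 -Z2snd.
  by have := congr1 snd Z0; rewrite -[LHS]/(Z1.2 + Z2.2 + Z3.2) Z1snd add0r.
have x0 i : x i = 0 by have /freeP/(_ x u0) := basis_free hb_basis; apply.
have y0 k : y k = 0.
  have := congr1 (fun X => fat_form br m l X e`_k) v0.
  rewrite (pred_linear_sumZ (fat_form_linearl g_lie m l _)) (bigD1 k) //=.
  rewrite (fat_dualP g_lie l_fat e_basis) eqxx scaleR_true big1 => [|i ik].
    by rewrite addr0 [X in _ = X -> _](pred_linear0 (fat_form_linearl g_lie m l _)).
  by rewrite (fat_dualP g_lie l_fat e_basis) (negPf ik) scaler0.
have z0 (i : 'I_(\dim h)) : (xi (left hb`_i) : R) = 0.
  suff : \sum_(i < \dim h) (xi (left hb`_i) : R) *: dual_vec hb i = 0.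
    by move/dual_vec_free/(_ i).
  have := congr1 fst Z0; rewrite /Z3 [X in LL X]v0 linear0 addr0 /=.
  rewrite /Z1 big1 ?scaler0 ?add0r => [|j _]; last first.
    by rewrite big1 // => k _; rewrite -!/(x _) !x0 !scale0r subrr scaler0.
  rewrite /Z2 raddf_sum => z0; apply/eqP; rewrite -oppr_eq0 -sumrN -[X in _ == X]z0.
  by apply/eqP; apply: eq_bigr => j _; rewrite /= scaler0 sub0r.
apply/lfunP => -[al w]; rewrite lfunE /=.
have -> : (al, w) = \sum_(i < \dim h)
    (al : 'Hom(subvs_of h, R^o)) (vsproj h hb`_i) *: dl i + (0, w).
  rewrite {1}(dual_vec_expand al); apply/pair_equal_spec; split => /=.
    by rewrite raddf_sum /= addr0.
  by rewrite raddf_sum /= big1 ?add0r // => i _; rewrite scaler0.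
rewrite linearD linear_sum big1 ?add0r => [|i _]; last first.
  by rewrite linearZ /= [xi _](x0 i) scaler0.
have [L' L'K LK] := L_bij; rewrite -(LK w) -[(0, _)]/(LL (L' w)).
rewrite -(h_part_add hm (L' w)).
rewrite (coord_span (X := hb) (v := vsval _)); last first.
  by rewrite (span_basis hb_basis); exact: subvsP.
rewrite (basis_expand e_basis (memv_pi _ _ _)) (linearD LL) (linearD xi).
rewrite !(linear_sum LL) !(linear_sum xi) !big1 ?addr0 // => i _.
  rewrite (linearZZ LL) (linearZZ xi); apply/eqP.
  by rewrite scaler_eq0; apply/orP; right; apply/eqP; exact: y0.
rewrite (linearZZ LL) (linearZZ xi); apply/eqP.
by rewrite scaler_eq0; apply/orP; right; apply/eqP; exact: z0.
Qed.

End Nondegeneracy.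

(** * Differentiability of maps between normed spaces *)

Section Differentiability.
Variable R : realType.

(** Differentiability is a local property; chart expressions of a composite agree
    with composites of chart expressions only near the point considered. *)
Lemma near_eq_is_diff (V W : normedModType R) (f k : V -> W) (a : V) (df : V -> W) :
  (\near a, f a = k a) -> is_diff a f df -> is_diff a k df.
Proof.
move=> fk [fa <-].
have E : k \o shift a = cst (k a) + 'd f a +o_ 0 id.
  have /eqaddoP fo := diff_locally fa; apply/eqaddoP => eps eps0.
  have fk0 : \forall x \near (0 : V), f (x + a) = k (x + a).
    by move: fk; rewrite [\forall x \near a, _](near_shift 0) subr0.
  have := fo eps eps0; apply: filter_app; near=> x.
  rewrite /= !fctE -(nbhs_singleton fk).
  by have -> : f (x + a) = k (x + a) by near: x.
have dE := diff_unique (diff_continuous fa) E.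
apply: DiffDef; last exact: dE.
apply/diff_locallyP; rewrite dE; split; last exact: E.
exact: diff_continuous.
Unshelve. all: by end_near. Qed.

Lemma near_eq_differentiable (V W : normedModType R) (f k : V -> W) (a : V) :
  (\near a, f a = k a) -> differentiable f a -> differentiable k a.
Proof. by move=> fk /differentiableP fa; case: (near_eq_is_diff fk fa). Qed.

Lemma near_eq_diff (V W : normedModType R) (f k : V -> W) (a : V) :
  (\near a, f a = k a) -> differentiable f a -> 'd f a = 'd k a :> (V -> W).
Proof. by move=> fk /differentiableP fa; case: (near_eq_is_diff fk fa) => _ ->. Qed.

Lemma continuous_linear_rV n (W : normedModType R) (f : {linear 'rV[R]_n -> W}) :
  continuous f.
Proof.
have -> : (f : _ -> _) = \sum_(i < n) (fun x : 'rV[R]_n => x 0 i *: f (delta_mx 0 i)).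
  apply/funext => x; rewrite {1}(row_sum_delta x) linear_sum fct_sumE.
  by apply: eq_bigr => i _; rewrite linearZ.
move=> x; apply: differentiable_continuous; apply: differentiable_sum => i.
by apply: differentiableZl; exact: differentiable_coord.
Qed.

Lemma differentiable_scale_rV n (V : normedModType R) (k : V -> R)
    (F : V -> 'rV[R]_n) x :
  differentiable k x -> differentiable F x -> differentiable (fun y => k y *: F y) x.
Proof.
move=> dk dF.
have -> : (fun y => k y *: F y) =
    \sum_(i < n) (fun y => (k * (fun y => F y 0 i)) y *: (delta_mx 0 i : 'rV[R]_n)).
  apply/funext => y; rewrite fct_sumE {1}(row_sum_delta (F y)) scaler_sumr.
  by apply: eq_bigr => i _; rewrite scalerA.
apply: differentiable_sum => i; apply/differentiableZl/differentiableM => //.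
exact: (differentiable_comp (g := fun N : 'rV[R]_n => N 0 i) dF (differentiable_coord _ _ _)).
Qed.

Lemma linear_diff_rV n (W : normedModType R) (f : {linear 'rV[R]_n -> W}) x :
  is_diff x f f.
Proof.
have fc := @continuous_linear_rV n W f.
by apply: DiffDef; [exact: linear_differentiable|rewrite diff_lin].
Qed.

(** How smoothness is proved here: a class of differentiable functions that is
    stable under directional derivatives consists of smooth functions. *)
Lemma smooth_on_class (V W : normedModType R) (D : set V) (K : (V -> W) -> Prop) :
  (forall f x, K f -> D x -> differentiable f x) ->
  (forall f v, K f -> K ('D_v f)) -> forall f, K f -> smooth_on D f.
Proof.
move=> Kd KD f Kf vs x Dx; apply: Kd => //.
by elim: vs => //= v vs; apply: KD.
Qed.

End Differentiability.

(** * Rational functions on an open set *)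

Section Rational.
Variables (R : realType) (V : normedModType R) (D : set V).
Hypothesis D_open : open D.

(** Rational functions without poles on D.  Inversion makes the entries of an
    inverse matrix belong to the class, and [rational_ext] makes the class
    insensitive to the values outside D, where no derivative is controlled. *)
Inductive rational_on : (V -> R) -> Prop :=
| rational_cst a : rational_on (cst a)
| rational_lin (f : {linear V -> R}) : continuous f -> rational_on f
| rational_add f k : rational_on f -> rational_on k -> rational_on (f + k)
| rational_mul f k : rational_on f -> rational_on k -> rational_on (f * k)
| rational_inv f : rational_on f -> (forall x, D x -> f x != 0) ->
    rational_on (fun x => (f x)^-1)
| rational_ext f k : (forall x, D x -> f x = k x) -> rational_on f -> rational_on k.

Lemma near_eq_on (T : Type) (f k : V -> T) x :
  (forall x, D x -> f x = k x) -> D x -> \near x, f x = k x.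
Proof. by move=> fk Dx; apply: filterS fk _; apply: open_nbhs_nbhs. Qed.

Lemma rational_differentiable f x : rational_on f -> D x -> differentiable f x.
Proof.
move=> fr; elim: fr x => {f}.
- by move=> a x _; exact: differentiable_cst.
- by move=> f fc x _; exact: linear_differentiable.
- by move=> f k _ IHf _ IHk x Dx; apply: differentiableD; [exact: IHf|exact: IHk].
- by move=> f k _ IHf _ IHk x Dx; apply: differentiableM; [exact: IHf|exact: IHk].
- by move=> f _ IHf f0 x Dx; apply: differentiableV; [exact: IHf|exact: f0].
- by move=> f k fk _ IHf x Dx; apply: near_eq_differentiable (IHf _ Dx); apply: near_eq_on.
Qed.

Lemma rational_derive f v : rational_on f -> rational_on ('D_v f).
Proof.
elim=> {f}.
- move=> a; apply: rational_ext (rational_cst 0) => x _.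
  by rewrite derive_cst.
- move=> f fc; apply: rational_ext (rational_cst (f v)) => x _.
  by rewrite deriveE ?diff_lin //; exact: linear_differentiable.
- move=> f k fr IHf kr IHk; apply: rational_ext (rational_add IHf IHk) => x Dx.
  by rewrite deriveD //; apply/diff_derivable/rational_differentiable.
- move=> f k fr IHf kr IHk.
  apply: rational_ext (rational_add (rational_mul fr IHk) (rational_mul kr IHf)) => x Dx.
  by rewrite deriveM //; apply/diff_derivable/rational_differentiable.
- move=> f fr IHf f0.
  apply: rational_ext (rational_mul (rational_cst (-1))
    (rational_mul (rational_mul (rational_inv fr f0) (rational_inv fr f0)) IHf)) => x Dx.
  rewrite deriveV ?f0 //; last exact/diff_derivable/rational_differentiable.
  by rewrite /= !fctE mulN1r expr2 invfM scaleNr.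
- move=> f k fk fr IHf; apply: rational_ext IHf => x Dx.
  exact/near_eq_derive/near_eq_on.
Qed.

Lemma rational_sum I (r : seq I) (F : I -> V -> R) :
  (forall i, rational_on (F i)) -> rational_on (fun x => \sum_(i <- r) F i x).
Proof.
move=> Fr; elim: r => [|i r IH].
  by apply: rational_ext (rational_cst 0) => x _; rewrite big_nil.
by apply: rational_ext (rational_add (Fr i) IH) => x _; rewrite big_cons.
Qed.

Lemma rational_prod I (r : seq I) (F : I -> V -> R) :
  (forall i, rational_on (F i)) -> rational_on (fun x => \prod_(i <- r) F i x).
Proof.
move=> Fr; elim: r => [|i r IH].
  by apply: rational_ext (rational_cst 1) => x _; rewrite big_nil.
by apply: rational_ext (rational_mul (Fr i) IH) => x _; rewrite big_cons.
Qed.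

Lemma rational_det n (A : V -> 'M[R]_n) :
  (forall i j, rational_on (fun x => A x i j)) -> rational_on (fun x => \det (A x)).
Proof.
move=> Ar; apply: rational_sum => s.
exact: rational_mul (rational_cst _) (rational_prod _ (fun i => Ar i _)).
Qed.

(** Cramer's rule. *)
Lemma rational_invmx n (A : V -> 'M[R]_n) :
  (forall i j, rational_on (fun x => A x i j)) ->
  (forall x, D x -> A x \in unitmx) ->
  forall i j, rational_on (fun x => invmx (A x) i j).
Proof.
move=> Ar Au i j.
have det0 x : D x -> \det (A x) != 0 by move=> /Au; rewrite unitmxE unitfE.
have cr : rational_on (fun x => cofactor (A x) j i).
  apply: rational_mul (rational_cst _) _; apply: rational_det => p q.
  by apply: rational_ext (Ar (lift j p) (lift i q)) => x _; rewrite !mxE.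
apply: rational_ext (rational_mul (rational_inv (rational_det Ar) det0) cr) => x Dx.
by rewrite /invmx Au // !mxE.
Qed.

(** Differentiate the identity invmx A *m A = 1, valid on the whole of D. *)
Lemma derive_invmx n (A : V -> 'M[R]_n) (A' : 'M[R]_n) x v :
  (forall i j, rational_on (fun x => A x i j)) ->
  (forall x, D x -> A x \in unitmx) -> D x ->
  (forall i j, 'D_v (fun x => A x i j) x = A' i j) ->
  forall i j, 'D_v (fun x => invmx (A x) i j) x
    = (- (invmx (A x) *m A' *m invmx (A x))) i j.
Proof.
move=> Ar Au Dx AE i j.
have cd p q : derivable (fun y => invmx (A y) p q) x v.
  exact/diff_derivable/rational_differentiable/Dx/rational_invmx.
have ad p q : derivable (fun y => A y p q) x v.
  exact/diff_derivable/rational_differentiable/Dx/Ar.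
pose c' := \matrix_(p, q) 'D_v (fun y => invmx (A y) p q) x.
suff -> : - (invmx (A x) *m A' *m invmx (A x)) = c' by rewrite mxE.
suff E : c' *m A x = - (invmx (A x) *m A') by rewrite -mulNmx -E mulmxK ?Au.
apply/matrixP => p q.
have : 'D_v (\sum_(k < n) ((fun y => invmx (A y) p k) * (fun y => A y k q))) x = 0.
  rewrite -[RHS](derive_cst ((p == q)%:R : R) x v); apply/near_eq_derive.
  apply: (@near_eq_on _ _ _ x) Dx => y Dy.
  have /matrixP/(_ p q) := mulVmx (Au y Dy); rewrite !mxE => <-.
  by rewrite fct_sumE; apply: eq_bigr => k _; rewrite !fctE.
rewrite derive_sum => [|k]; last exact: derivableM.
under eq_bigr do rewrite deriveM // AE.
rewrite big_split /= addrC => /eqP; rewrite addr_eq0 => /eqP; rewrite !mxE => E.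
by under eq_bigr do rewrite mxE mulrC; rewrite E.
Qed.

Lemma rational_vec_diff (W : normedModType R) (I : finType) (F : I -> V -> R)
    (w : I -> W) f x :
  (forall i, rational_on (F i)) ->
  (forall x, D x -> f x = \sum_i F i x *: w i) -> D x ->
  differentiable f x /\ forall v, 'D_v f x = \sum_i 'D_v (F i) x *: w i.
Proof.
move=> Fr fE Dx; pose n := #|{: I}|.
have sumE (k : I -> W) : \sum_i k i = \sum_(i < n) k (enum_val i).
  by rewrite (reindex _ (onW_bij _ (enum_val_bij I))).
pose F' (i : 'I_n) y := F (enum_val i) y *: w (enum_val i).
have fE' : \near x, (\sum_i F' i) x = f x.
  by apply: (@near_eq_on _ _ _ x) Dx => y Dy; rewrite fE // sumE fct_sumE.
have Fd i : differentiable (F' i) x.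
  exact/differentiableZl/rational_differentiable.
split; first exact: near_eq_differentiable fE' (differentiable_sum Fd).
move=> v; rewrite -(near_eq_derive v fE') derive_sum => [|i]; last exact: diff_derivable.
rewrite sumE; apply: eq_bigr => i _; rewrite deriveE // diffZl ?deriveE //.
  exact: rational_differentiable.
exact: rational_differentiable.
Qed.

Lemma rational_smooth (W : normedModType R) (I : finType) (F : I -> V -> R)
    (w : I -> W) f :
  (forall i, rational_on (F i)) ->
  (forall x, D x -> f x = \sum_i F i x *: w i) -> smooth_on D f.
Proof.
move=> Fr fE.
pose K (k : V -> W) := exists G : I -> V -> R, (forall i, rational_on (G i)) /\
  forall x, D x -> k x = \sum_i G i x *: w i.
apply: (@smooth_on_class _ _ _ D K); last by exists F.
  by move=> k x [G [Gr kE]] Dx; have [] := rational_vec_diff Gr kE Dx.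
move=> k v [G [Gr kE]]; exists (fun i => 'D_v (G i)); split=> [i|x Dx].
  exact: rational_derive.
by have [_ ->] := rational_vec_diff Gr kE Dx.
Qed.

End Rational.

(** * Linear differential equations with zero initial value *)

Section LinearODE.
Variable R : realType.

Lemma itv01_oo_cc (t : R) : t \in `]0, 1[%R -> t \in `[0, 1]%R.
Proof. by rewrite !in_itv /= => /andP[/ltW -> /ltW ->]. Qed.

(** The function f s exp (- C s) is nonincreasing, nonnegative and vanishes
    at 0. *)
Lemma gronwall_zero (f df : R -> R) (C : R) :
  (forall s : R, s \in `[0, 1]%R -> is_derive s 1 f (df s)) ->
  (forall s : R, s \in `[0, 1]%R -> df s <= C * f s) ->
  (forall s, 0 <= f s) -> f 0 = 0 -> forall s : R, s \in `[0, 1]%R -> f s = 0.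
Proof.
move=> fd dfC f_ge0 f0 s s01.
pose k : R -> R := f * (expR \o (fun t => - C * t)).
have kd (t : R) : t \in `[0, 1]%R ->
    is_derive t 1 k (f t *: (expR (- C * t) * - C) + expR (- C * t) *: df t).
  move=> t01; apply: is_deriveM; first exact: fd.
  apply: is_derive1_comp.
  by apply: is_derive_eq; rewrite scaler1.
have ks : k s <= k 0.
  have [s0 s1] := andP s01.
  apply: (@ler0_derive1_le_cc _ k 0 1) => //.
  - by move=> t t01; have [] := kd t (itv01_oo_cc t01).
  - move=> t t01; have kdt := kd t (itv01_oo_cc t01).
    rewrite derive1E derive_val.
    have -> : f t *: (expR (- C * t) * - C) + expR (- C * t) *: df t
       = expR (- C * t) * (df t - C * f t) by rewrite /GRing.scale /=; ring.
    rewrite pmulr_rle0 ?expR_gt0 // subr_le0 dfC //; exact: itv01_oo_cc.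
  - apply: derivable_within_continuous => t t01; by have [] := kd t t01.
  - by rewrite in_itv /= lexx ler01.
apply/eqP; rewrite eq_le f_ge0 andbT -(pmulr_lle0 _ (expR_gt0 (- C * s))).
by apply: le_trans ks _; rewrite /k /= fctE f0 mul0r.
Qed.

(** The squared Euclidean norm f of y satisfies f' <= 2 n K f, where K bounds the
    absolute values of the entries of M on the segment. *)
Lemma linear_ode_zero n (y : 'I_n -> R -> R) (M : 'I_n -> 'I_n -> R -> R) :
  (forall s : R, s \in `[0, 1]%R ->
     forall j, is_derive s 1 (y j) (\sum_p M j p s * y p s)) ->
  (forall s : R, s \in `[0, 1]%R -> forall j p, {for s, continuous (M j p)}) ->
  (forall j, y j 0 = 0) -> forall s : R, s \in `[0, 1]%R -> forall j, y j s = 0.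
Proof.
move=> yd Mc y0.
pose K : R -> R := \sum_j \sum_p (fun s => `|M j p s|).
have Kc : {within `[0, 1], continuous K}.
  apply: continuous_in_subspaceT => s s01; have {}s01 : s \in `[0, 1]%R by rewrite inE in s01.
  apply: (big_ind (fun k : R -> R => {for s, continuous k})) => [|f k|j _].
  - exact: cst_continuous.
  - exact: continuousD.
  apply: (big_ind (fun k : R -> R => {for s, continuous k})) => [|f k|p _].
  - exact: cst_continuous.
  - exact: continuousD.
  by apply: (continuous_comp (Mc s s01 j p)); exact: norm_continuous.
have [c c01 KC] := EVT_max ler01 Kc.
have MC (s : R) j p : s \in `[0, 1]%R -> `|M j p s| <= K c.
  move=> s01; apply: le_trans (KC s s01); rewrite /K fct_sumE (bigD1 j) //=.
  rewrite fct_sumE (bigD1 p) //= -addrA lerDl addr_ge0 ?sumr_ge0 // => i _.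
  by rewrite fct_sumE sumr_ge0.
pose f : R -> R := \sum_j (y j * y j).
have fE s : f s = \sum_j y j s * y j s by rewrite /f fct_sumE.
suff fz (s : R) : s \in `[0, 1]%R -> f s = 0.
  move=> s s01 j; apply/eqP; rewrite -sqrf_eq0 expr2; apply/eqP.
  have /eqP := fz s s01; rewrite fE psumr_eq0 => [|i _]; last by rewrite -expr2 sqr_ge0.
  by move/allP/(_ j (mem_index_enum _))/implyP/(_ isT)/eqP.
apply: (@gronwall_zero f (fun s => \sum_j (y j s *: (\sum_p M j p s * y p s)
    + y j s *: (\sum_p M j p s * y p s))) (K c * n%:R *+ 2)).
- by move=> t t01; apply: is_derive_sum => j; apply: is_deriveM; apply: yd.
- move=> t t01; rewrite fE.
  have -> : K c * n%:R *+ 2 * (\sum_j y j t * y j t)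
    = \sum_j \sum_p K c * (y j t * y j t + y p t * y p t).
    under [RHS]eq_bigr do rewrite -mulr_sumr big_split /= sumr_const card_ord.
    rewrite -mulr_sumr big_split /= sumr_const card_ord sumrMnl.
    set S := \sum_(i < n) _; rewrite -(mulr_natr S n) -(mulr_natr _ 2); ring.
  apply: ler_sum => j _; rewrite scaler_sumr -mulr2n -sumrMnl; apply: ler_sum => p _.
  have := MC t j p t01.
  set a := M j p t; set u := y j t; set v := y p t => aK.
  move: aK; rewrite ler_norml => /andP[aK1 aK2].
  rewrite -subr_ge0 (_ : _ - _ = ((K c - a) * (u + v) ^+ 2 + (K c + a) * (u - v) ^+ 2) / 2).
    by rewrite divr_ge0 // addr_ge0 // mulr_ge0 ?sqr_ge0 //; lra.
  by rewrite /GRing.scale /= -(mulr_natr _ 2); field.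
- by move=> t; rewrite fE sumr_ge0 // => i _; rewrite -expr2 sqr_ge0.
by rewrite fE big1 // => j _; rewrite y0 mul0r.
Qed.

End LinearODE.

(** * Tangent maps in charts *)

Section Charts.
Variables (R : realType).

Lemma cmap_cimg (T : topologicalType) n (c : chart R T n) x :
  cdom c x -> cimg c (cmap c x).
Proof. by exists x. Qed.

Lemma cinv_cdom (T : topologicalType) n (c : chart R T n) u :
  cimg c u -> cdom c (cinv c u).
Proof. by move=> [x cx <-]; rewrite cmapK. Qed.

Lemma cinvK (T : topologicalType) n (c : chart R T n) u :
  cimg c u -> cmap c (cinv c u) = u.
Proof. by move=> [x cx <-]; rewrite cmapK. Qed.

Lemma near_cimg (T : topologicalType) n (c : chart R T n) x :
  cdom c x -> \forall u \near cmap c x, cimg c u.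
Proof.
by move=> cx; apply: open_nbhs_nbhs; split; [exact: cimg_open|exact: cmap_cimg].
Qed.

Lemma near_cinv (T : topologicalType) n (c : chart R T n) x (U : set T) :
  cdom c x -> nbhs x U -> \forall u \near cmap c x, U (cinv c u).
Proof.
by move=> cx Ux; apply: (cinv_continuous cx); rewrite cmapK.
Qed.

Lemma nbhs_cdom (T : topologicalType) n (c : chart R T n) x :
  cdom c x -> nbhs x (cdom c).
Proof. by move=> cx; apply: open_nbhs_nbhs; split=> //; exact: cdom_open. Qed.

Variables (M N P : manifoldType R).
Variables (c : chart R M (@mdim R M)) (d : chart R N (@mdim R N)) (e : chart R P (@mdim R P)).

Lemma near_chart_comp (f : M -> N) (k : N -> P) x :
  cdom c x -> cdom d (f x) -> {for x, continuous f} ->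
  \forall u \near cmap c x, ((cmap e \o k \o cinv d) \o (cmap d \o f \o cinv c)) u
     = (cmap e \o (k \o f) \o cinv c) u.
Proof.
move=> cx dfx fx.
have := near_cinv cx (fx _ (nbhs_cdom dfx)); apply: filterS => u /= du.
by rewrite cmapK.
Qed.

(** The chain rule. *)
Lemma tmap_comp (f : M -> N) (k : N -> P) x :
  cdom c x -> cdom d (f x) -> {for x, continuous f} ->
  differentiable (cmap d \o f \o cinv c) (cmap c x) ->
  differentiable (cmap e \o k \o cinv d) (cmap d (f x)) ->
  differentiable (cmap e \o (k \o f) \o cinv c) (cmap c x) /\
  tmap c e (k \o f) x = tmap d e k (f x) \o tmap c d f x.
Proof.
move=> cx dfx fx df dk.
have E : (cmap d \o f \o cinv c) (cmap c x) = cmap d (f x) by rewrite /= cmapK.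
rewrite -E in dk.
have D := differentiable_comp df dk; have near_eq := near_chart_comp k cx dfx fx.
split; first exact: near_eq_differentiable near_eq D.
apply: etrans (esym (near_eq_diff near_eq D)) _.
apply: etrans (diff_comp df dk) _.
by rewrite E.
Qed.

Lemma smooth_map_diff (f : M -> N) x : smooth_map f -> atlas c -> atlas d ->
  cdom c x -> cdom d (f x) -> differentiable (cmap d \o f \o cinv c) (cmap c x).
Proof.
move=> [_ fs] ac ad cx dfx; apply: (fs c d ac ad [::]) => /=.
by split; [exact: cmap_cimg|rewrite cmapK].
Qed.

Lemma smooth_map2_diffr (f : M -> N -> P) a x : smooth_map2 f -> atlas d -> atlas e ->
  cdom d x -> cdom e (f a x) -> differentiable (cmap e \o f a \o cinv d) (cmap d x).
Proof.
move=> [_ fs] ad ae dx efx; have [c' ac ca] := atlas_cover a.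
have D : differentiable (fun p => cmap e (f (cinv c' p.1) (cinv d p.2))) (cmap c' a, cmap d x).
  apply: (fs c' d e ac ad ae [::]) => /=.
  by split; [exact: cmap_cimg|exact: cmap_cimg|rewrite !cmapK].
have -> : cmap e \o f a \o cinv d =
   (fun p => cmap e (f (cinv c' p.1) (cinv d p.2))) \o (fun u => (cmap c' a, u)).
  by apply/funext => u /=; rewrite cmapK.
apply: differentiable_comp D; apply: differentiable_pair.
  exact: differentiable_cst.
by apply: ex_diff.
Qed.

Lemma smooth_map2_diffl (f : M -> N -> P) a x : smooth_map2 f -> atlas c -> atlas e ->
  cdom c x -> cdom e (f x a) -> differentiable (cmap e \o f^~ a \o cinv c) (cmap c x).
Proof.
move=> [_ fs] ac ae cx efx; have [c' ac' ca] := atlas_cover a.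
have D : differentiable (fun p => cmap e (f (cinv c p.1) (cinv c' p.2))) (cmap c x, cmap c' a).
  apply: (fs c c' e ac ac' ae [::]) => /=.
  by split; [exact: cmap_cimg|exact: cmap_cimg|rewrite !cmapK].
have -> : cmap e \o f^~ a \o cinv c =
   (fun p => cmap e (f (cinv c p.1) (cinv c' p.2))) \o (fun u => (u, cmap c' a)).
  by apply/funext => u /=; rewrite cmapK.
apply: differentiable_comp D; apply: differentiable_pair.
  by apply: ex_diff.
exact: differentiable_cst.
Qed.

Lemma smooth2_continuousr (f : M -> N -> P) a : smooth_map2 f -> continuous (f a).
Proof.
move=> [fc _] x; pose pr (y : N) : M * N := (a, y).
apply: (continuous_comp (f := pr) (g := fun p => f p.1 p.2)); last exact: fc.
by apply: cvg_pair; [exact: cvg_cst|exact: cvg_id].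
Qed.

Lemma smooth2_continuousl (f : M -> N -> P) a : smooth_map2 f -> continuous (f^~ a).
Proof.
move=> [fc _] x; pose pr (y : M) : M * N := (y, a).
apply: (continuous_comp (f := pr) (g := fun p => f p.1 p.2)); last exact: fc.
by apply: cvg_pair; [exact: cvg_id|exact: cvg_cst].
Qed.

End Charts.

(** * Translations and conjugations of a Lie group *)

Section LieGroup.
Variables (R : realType) (G : lieGroupType R).
Implicit Types (c d : chart R G (@mdim R G)) (x y z : G).

Lemma mulg_continuousr x : continuous (fun y : G => (x * y)%g).
Proof. exact: smooth2_continuousr (lie_mul_smooth (s := G)). Qed.

Lemma mulg_continuousl y : continuous (fun x : G => (x * y)%g).
Proof. exact: smooth2_continuousl (lie_mul_smooth (s := G)). Qed.

Lemma invg_continuous : continuous (fun x : G => (x^-1)%g).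
Proof. exact: (lie_inv_smooth (s := G)).1. Qed.

Lemma tmap_id c x : cdom c x -> tmap c c id x = id.
Proof.
move=> cx; rewrite /tmap.
have near_id : \forall u \near cmap c x, id u = (cmap c \o id \o cinv c) u.
  by have := near_cimg cx; apply: filterS => u /= /cinvK.
apply: etrans (esym (near_eq_diff near_id _)) _; first exact: ex_diff.
exact: diff_val.
Qed.

Lemma left_translation_diff c d x y : atlas c -> atlas d -> cdom c y -> cdom d (x * y)%g ->
  differentiable (cmap d \o (fun z => (x * z)%g) \o cinv c) (cmap c y).
Proof. exact: smooth_map2_diffr (lie_mul_smooth (s := G)). Qed.

Lemma right_translation_diff c d x y : atlas c -> atlas d -> cdom c x -> cdom d (x * y)%g ->
  differentiable (cmap d \o (fun z => (z * y)%g) \o cinv c) (cmap c x).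
Proof. exact: smooth_map2_diffl (lie_mul_smooth (s := G)). Qed.

Definition conjugation y z : G := (y * z * y^-1)%g.

Lemma conjugation_continuous y : continuous (conjugation y).
Proof.
move=> x; apply: (continuous_comp (f := fun z => (y * z)%g) (g := fun z => (z * y^-1)%g)).
  exact: mulg_continuousr.
exact: mulg_continuousl.
Qed.

Lemma conjugation1 y : conjugation y 1%g = 1%g.
Proof. by rewrite /conjugation mulg1 mulgV. Qed.

Lemma conjugation_diff c y : atlas c -> cdom c 1%g ->
  differentiable (cmap c \o conjugation y \o cinv c) (cmap c 1%g).
Proof.
move=> ac c1; have [d ad dy] := atlas_cover y.
have dy1 : cdom d (y * 1)%g by rewrite mulg1.
apply: (proj1 (tmap_comp (k := fun z => (z * y^-1)%g) c1 dy1 _ _ _)).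
- exact: mulg_continuousr.
- exact: left_translation_diff.
- by apply: right_translation_diff; rewrite // mulg1 mulgV.
Qed.

Lemma tmap_conjM c y z : atlas c -> cdom c 1%g ->
  tmap c c (conjugation (y * z)%g) 1%g
  = tmap c c (conjugation y) 1%g \o tmap c c (conjugation z) 1%g.
Proof.
move=> ac c1.
have -> : conjugation (y * z)%g = conjugation y \o conjugation z.
  by apply/funext => u; rewrite /= /conjugation invgM !mulgA.
have cz : cdom c (conjugation z 1%g) by rewrite conjugation1.
rewrite (proj2 (tmap_comp (e := c) (k := conjugation y) c1 cz _ _ _)).
- by rewrite conjugation1.
- exact: conjugation_continuous.
- exact: conjugation_diff.
- by rewrite conjugation1; exact: conjugation_diff.
Qed.

Lemma tmap_conj1 c : cdom c 1%g -> tmap c c (conjugation 1%g) 1%g = id.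
Proof.
move=> c1; rewrite -(tmap_id c1); congr (tmap _ _ _ _).
by apply/funext => u; rewrite /conjugation mul1g invg1 mulg1.
Qed.

(** The inverse is the tangent map of the inverse translation. *)
Lemma left_translation_bij c d y : atlas c -> atlas d -> cdom c 1%g -> cdom d y ->
  bijective (tmap c d (fun z => (y * z)%g) 1%g).
Proof.
move=> ac ad c1 dy; have dy1 : cdom d (y * 1)%g by rewrite mulg1.
have c1' : cdom c (y^-1 * y)%g by rewrite mulVg.
exists (tmap d c (fun z => (y^-1 * z)%g) y) => v.
  have Lid : (fun z => (y^-1 * z)%g) \o (fun z => (y * z)%g) = id.
    by apply/funext => z /=; rewrite mulKg.
  have := proj2 (tmap_comp (e := c) (k := fun z => (y^-1 * z)%g) c1 dy1 _ _ _).
  rewrite Lid tmap_id // mulg1 => E; rewrite -[RHS]/(id v) E //.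
  - exact: mulg_continuousr.
  - exact: left_translation_diff.
  - by apply: left_translation_diff.
have Lid : (fun z => (y * z)%g) \o (fun z => (y^-1 * z)%g) = id.
  by apply/funext => z /=; rewrite mulVKg.
have := proj2 (tmap_comp (e := d) (k := fun z => (y * z)%g) dy c1' _ _ _).
rewrite Lid tmap_id // mulVg => E; rewrite -[RHS]/(id v) E //.
- exact: mulg_continuousr.
- exact: left_translation_diff.
- by apply: left_translation_diff.
Qed.

End LieGroup.

(** * The group law in a chart at the identity *)

Section PartialDifferentials.
Variables (R : realType) (U V W : normedModType R) (F : U * V -> W).

Lemma is_diff_partialr (a : U) (b : V) : differentiable F (a, b) ->
  is_diff b (fun y => F (a, y)) (fun v => 'd F (a, b) (0, v)).
Proof.
move=> /differentiableP dF.
have ip : is_diff b (fun y : V => (a, y)) (fun v => (0, v)) by apply: is_diff_pair.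
exact: (@is_diff_comp _ _ _ _ _ _ _ _ b ip dF).
Qed.

Lemma is_diff_partiall (a : U) (b : V) : differentiable F (a, b) ->
  is_diff a (fun x => F (x, b)) (fun u => 'd F (a, b) (u, 0)).
Proof.
move=> /differentiableP dF.
have ip : is_diff a (fun x : U => (x, b)) (fun u => (u, 0)) by apply: is_diff_pair.
exact: (@is_diff_comp _ _ _ _ _ _ _ _ a ip dF).
Qed.

End PartialDifferentials.

Section LocalGroup.
Variables (R : realType) (G : lieGroupType R) (c : chart R G (@mdim R G)).
Hypothesis c_atlas : atlas c.
Hypothesis c1 : cdom c 1%g.
Local Notation n := (@mdim R G).
Implicit Types (u v : 'rV[R]_n) (p w : 'rV[R]_n * 'rV[R]_n).

Definition loc_mul p : 'rV[R]_n := cmap c (cinv c p.1 * cinv c p.2)%g.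
Definition loc_inv u : 'rV[R]_n := cmap c (cinv c u)^-1%g.
(** [cinv c] is arbitrary outside the image of the chart, so [loc_mul] and
    [loc_inv] are meaningful only on these sets. *)
Definition loc_dom p :=
  [/\ cimg c p.1, cimg c p.2 & cdom c (cinv c p.1 * cinv c p.2)%g].
Definition loc_invertible u := cimg c u /\ cdom c (cinv c u)^-1%g.

Lemma loc_mul_diff p : loc_dom p -> differentiable loc_mul p.
Proof. exact: ((lie_mul_smooth (s := G)).2 c c c c_atlas c_atlas c_atlas [::]). Qed.

(** The adjoint representation at x is a first derivative of the group law, so
    its differentiability in x uses the second derivatives of the law. *)
Lemma loc_mul_derive_diff w p : loc_dom p -> differentiable ('D_w loc_mul) p.
Proof. exact: ((lie_mul_smooth (s := G)).2 c c c c_atlas c_atlas c_atlas [:: w]). Qed.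

Lemma near_loc_invertible : \forall u \near cmap c 1%g, loc_invertible u.
Proof.
apply: filterI; first exact: near_cimg.
apply: (near_cinv c1 (U := fun x => cdom c x^-1%g)).
by apply: (@invg_continuous R G 1%g); rewrite invg1; exact: nbhs_cdom.
Qed.

Lemma loc_inv_diff u : loc_invertible u -> differentiable loc_inv u.
Proof.
move=> [cu ciu]; rewrite -(cinvK cu).
apply: (@smooth_map_diff R G G c c (fun x : G => x^-1%g)) => //.
  exact: lie_inv_smooth.
exact: cinv_cdom.
Qed.

Lemma cinv_loc_inv u : loc_invertible u -> cinv c (loc_inv u) = (cinv c u)^-1%g.
Proof. by move=> [_ ciu]; rewrite /loc_inv cmapK. Qed.

Lemma loc_dom_invl u : loc_invertible u -> loc_dom (loc_inv u, u).
Proof.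
move=> cu; split=> /=; rewrite ?cinv_loc_inv ?mulVg //; last by case: cu.
by apply: cmap_cimg; case: cu.
Qed.

Lemma loc_dom_invr u : loc_invertible u -> loc_dom (u, loc_inv u).
Proof.
move=> cu; split=> /=; rewrite ?cinv_loc_inv ?mulgV //; first by case: cu.
by apply: cmap_cimg; case: cu.
Qed.

Lemma loc_mul_invl u : loc_invertible u -> loc_mul (loc_inv u, u) = cmap c 1%g.
Proof. by move=> cu; rewrite /loc_mul /= cinv_loc_inv // mulVg. Qed.

End LocalGroup.

(** * Invariant subspaces of a connected Lie group *)

Section InvariantSubspace.
Variables (R : realType) (K : lieGroupType R) (g : vectType R).
Variables (P : K -> g -> g) (W : {vspace g}) (c : chart R K (@mdim R K)).
Hypothesis c_atlas : atlas c.
Hypothesis c1 : cdom c 1%g.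
Hypothesis K_connected : connected [set: K].
Hypothesis P_linear : forall x, linear (P x).
Hypothesis P_mul : forall x y X, P (x * y)%g X = P x (P y X).
Hypothesis P_one : forall X, P 1%g X = X.

Local Notation u0 := (cmap c 1%g).
Let Phi (Y : g) (u : 'rV[R]_(@mdim R K)) : 'rV[R]_(dim g) := v2r (P (cinv c u) Y).

Hypothesis P_diff : forall Y, differentiable (Phi Y) u0.
Hypothesis P_W : forall Y, Y \in W -> forall v, r2v ('d (Phi Y) u0 v) \in W.

(* kappa u is the left translation by the inverse of u, and zeta v u is the
   velocity v at u brought back to the identity by kappa u. *)
Let kappa u b := loc_mul c (loc_inv c u, b).
Let zeta (v u : 'rV[R]_(@mdim R K)) : 'rV[R]_(@mdim R K) :=
  'D_(0, v) (loc_mul c) (loc_inv c u, u).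
Let PL x : {linear g -> g} := HB.pack (P x) (GRing.isLinear.Build _ _ _ _ (P x) (P_linear x)).

(** Near u, P b = P u (P (u^-1 b)), so the derivative of P at u is determined by
    its derivative at the identity. *)
Let Phi_is_diff Y u : loc_invertible c u ->
  is_diff u (Phi Y) (fun v => v2r (P (cinv c u) (r2v ('d (Phi Y) u0 (zeta v u))))).
Proof.
move=> cu; have ku0 : kappa u u = u0 by exact: loc_mul_invl.
have kd : is_diff u (kappa u) (zeta^~ u).
  have dm := loc_mul_diff c_atlas (loc_dom_invl c1 cu).
  apply: is_diff_eq (is_diff_partialr dm) _.
  by apply/funext => v; rewrite /zeta deriveE.
pose A : {linear 'rV[R]_(dim g) -> 'rV[R]_(dim g)} := v2r \o PL (cinv c u) \o r2v.
have near_eq : \forall b \near u, (A \o (Phi Y \o kappa u)) b = Phi Y b.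
  case: (cu) => cuu cui.
  have nU : nbhs (cinv c u) (fun z => cdom c ((cinv c u)^-1 * z)%g).
    by apply: (@mulg_continuousr R K (cinv c u)^-1%g (cinv c u)); rewrite mulVg; exact: nbhs_cdom.
  have := near_cinv (cinv_cdom cuu) nU; rewrite cinvK //; apply: filterS => b /= cb.
  by rewrite v2rK /Phi /kappa /loc_mul /= cinv_loc_inv // cmapK // -P_mul mulVKg.
apply: near_eq_is_diff near_eq _.
have dPhi : is_diff (kappa u u) (Phi Y) ('d (Phi Y) u0).
  by rewrite ku0; exact/differentiableP.
have dA z : is_diff z A A by exact: linear_diff_rV.
have d1 : is_diff u (Phi Y \o kappa u) ('d (Phi Y) u0 \o zeta^~ u).
  exact: is_diff_comp.
exact: (@is_diff_comp _ _ _ _ _ _ A A u d1 (dA _)).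
Qed.

Let zeta_cont v u : loc_invertible c u -> {for u, continuous (zeta v)}.
Proof.
move=> cu; apply: differentiable_continuous.
pose pr b : 'rV[R]_(@mdim R K) * 'rV[R]_(@mdim R K) := (loc_inv c b, b).
apply: (@differentiable_comp _ _ _ _ pr ('D_(0, v) (loc_mul c))).
  by apply: differentiable_pair; [exact: loc_inv_diff|exact: ex_diff].
exact/loc_mul_derive_diff/(loc_dom_invl c1).
Qed.

(** Let w_j be a basis of W and y_j the class of P w_j modulo W along the segment.
    By the previous formula and since the derivative at the identity preserves W,
    the y_j solve a linear system, and they vanish at the identity. *)
Let segment_W v : (forall s : R, s \in `[0, 1]%R -> loc_invertible c (u0 + s *: v)) ->
  forall Y, Y \in W -> P (cinv c (u0 + v)) Y \in W.
Proof.
move=> inv Y YW.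
pose w (j : 'I_(\dim W)) := (vbasis W)`_j.
have wW j : w j \in W by apply: vbasis_mem; rewrite mem_nth ?size_tuple.
(* B0 is the projection modulo W, with values in a complement of W. *)
pose B0 (z : 'rV[R]_(dim g)) := v2r (r2v z - projv W (r2v z)).
have B0_linear : linear B0.
  by move=> a x y; rewrite /B0 (linearP r2v) (linearP (projv W)) linearP_sub linearP.
pose B : {linear 'rV[R]_(dim g) -> 'rV[R]_(dim g)} :=
  HB.pack B0 (GRing.isLinear.Build _ _ _ _ B0 B0_linear).
pose line (s : R) := u0 + s *: v.
pose y q j s : R := B (Phi (w j) (line s)) 0 q.
pose N j z := r2v ('d (Phi (w j)) u0 z).
pose M j p s := coord (vbasis W) p (N j (zeta v (line s))).
have line_diff s : is_diff s line (fun k => k *: v).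
  apply: is_diff_eq; apply/funext => k; rewrite /= !fctE add0r //.
have d1 (s : R) j : s \in `[0, 1]%R -> is_diff s (B \o (Phi (w j) \o line))
   (B \o ((fun v => v2r (P (cinv c (line s)) (N j (zeta v (line s))))) \o (fun k => k *: v))).
  move=> s01; have dPhi := Phi_is_diff (w j) (inv s s01).
  have d2 : is_diff s (Phi (w j) \o line)
    ((fun v => v2r (P (cinv c (line s)) (N j (zeta v (line s))))) \o (fun k => k *: v)).
    exact: (@is_diff_comp _ _ _ _ _ _ _ _ s (line_diff s) dPhi).
  exact: (@is_diff_comp _ _ _ _ _ _ B B s d2 (linear_diff_rV _ _)).
have yd (q : 'I_(dim g)) (s : R) : s \in `[0, 1]%R ->
    forall j, is_derive s 1 (y q j) (\sum_p M j p s * y q p s).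
  move=> s01 j; have dd := d1 s j s01.
  have dv : derivable (B \o (Phi (w j) \o line)) s 1.
    exact: diff_derivable (ex_diff (is_diff_def := dd)).
  have -> : \sum_p M j p s * y q p s = 'D_1 (y q j) s.
    have -> : 'D_1 (y q j) s = ('D_1 (B \o (Phi (w j) \o line)) s) 0 q.
      by rewrite derive_mx // mxE.
    rewrite deriveE; last exact: (ex_diff (is_diff_def := dd)).
    rewrite (diff_val (is_diff_def := dd)) /comp scale1r.
    have NW : N j (zeta v (line s)) \in W by apply: P_W.
    rewrite (coord_vbasis NW) (pred_linear_sumZ (P_linear _)) !linear_sum summxE.
    by apply: eq_bigr => p _; rewrite !linearZ mxE.
  apply: derivableP.
  exact: ((derivable_mxP _ _ _).1 dv 0 q).
have yM (s : R) : s \in `[0, 1]%R -> forall j p, {for s, continuous (M j p)}.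
  move=> s01 j p; pose L0 (z : 'rV[R]_(@mdim R K)) : R^o := coord (vbasis W) p (N j z).
  have L0_linear : linear L0 by move=> a x z; rewrite /L0 /N !linearP.
  pose L : {linear 'rV[R]_(@mdim R K) -> R^o} :=
    HB.pack L0 (GRing.isLinear.Build _ _ _ _ L0 L0_linear).
  apply: (@continuous_comp _ _ _ (zeta v \o line) L s); last exact: continuous_linear_rV.
  apply: continuous_comp; last exact/zeta_cont/inv.
  exact: differentiable_continuous (ex_diff (is_diff_def := line_diff s)).
have y0 q j : y q j 0 = 0.
  rewrite /y /line scale0r addr0 /Phi cmapK // P_one /= /B0 v2rK.
  by rewrite projv_id // subrr linear0 mxE.
have one01 : (1 : R) \in `[0, 1]%R by rewrite in_itv /= ler01 lexx.
have PW j : P (cinv c (u0 + v)) (w j) \in W.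
  have y1 q : y q j 1 = 0.
    exact: (@linear_ode_zero R _ (y q) M (yd q) yM (y0 q) 1 one01).
  have : B (Phi (w j) (line 1)) = 0 by apply/rowP => q; rewrite mxE; exact: y1.
  rewrite /= /B0 /Phi v2rK /line scale1r => /(congr1 (@r2v R g)).
  by rewrite v2rK linear0 => /eqP; rewrite subr_eq0 => /eqP ->; exact: memv_proj.
rewrite (coord_vbasis YW) (pred_linear_sumZ (P_linear _)).
by apply: memv_suml => j _; apply: memvZ; exact: PW.
Qed.

Let near1_W : \forall x \near (1%g : K), forall Y, Y \in W -> P x Y \in W.
Proof.
have /nbhs_ballP [r /= r0 ru] := near_loc_invertible c1.
have : \forall x \near (1%g : K), cdom c x /\ ball u0 r (cmap c x).
  apply: filterI; first exact: nbhs_cdom.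
  by apply: (cmap_continuous c1); exact: nbhsx_ballx.
apply: filterS => x [cx xr] Y YW.
have xE : x = cinv c (u0 + (cmap c x - u0)) by rewrite addrC subrK cmapK.
rewrite xE; apply: segment_W YW => s /andP[s0 s1].
apply: ru; move: xr; rewrite -!ball_normE /= => xr.
rewrite opprD addNKr normrN normrZ (ger0_norm s0) distrC (le_lt_trans _ xr) //.
by rewrite ler_piMl.
Qed.

(** The elements that preserve W form a submonoid containing a neighbourhood of
    the identity, by the previous lemma.  It is therefore open and closed, and the
    group is connected. *)
Theorem invariant_subspace x Y : Y \in W -> P x Y \in W.
Proof.
pose S := [set x : K | forall Y, Y \in W -> P x Y \in W].
(* Inverses are included in N because S is only known to be a submonoid. *)
pose N := [set n : K | S n /\ S n^-1%g].
have N1 : nbhs (1%g : K) N.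
  apply: filterI; first exact: near1_W.
  by apply: (@invg_continuous R K 1%g); rewrite invg1; exact: near1_W.
have near_N y : nbhs y [set z | N (y^-1 * z)%g].
  by apply: (@mulg_continuousr R K y^-1%g y); rewrite mulVg.
have SM y z : S y -> S z -> S (y * z)%g.
  by move=> Sy Sz Z ZW; rewrite P_mul; apply/Sy/Sz.
have S_open : open S.
  rewrite openE => y Sy; apply: filterS (near_N y) => z [Sz _].
  by rewrite -(mulVKg y z); apply: SM.
have S_closed : closed S.
  rewrite -[S]setCK; apply: open_closedC; rewrite openE => y nSy.
  apply: filterS (near_N y) => z [_ Sz] SzS; apply: nSy.
  by have := SM _ _ SzS Sz; rewrite invgM invgK mulVKg.
have ST : S = setT.
  apply: K_connected.
  - by exists 1%g => Z ZW; rewrite P_one.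
  - by exists S => //; rewrite setTI.
  - by exists S => //; rewrite setTI.
move=> YW; have : [set: K] x by [].
by rewrite -ST; apply.
Qed.

End InvariantSubspace.

(** * The adjoint representation *)

Section Adjoint.
Variables (R : realType) (G : lieGroupType R) (g : vectType R) (t : tangent_iso G g).
Local Notation c := (ti_chart t).
Let c_atlas : atlas c := ti_atlas t.
Let c1 : cdom c 1%g := ti_dom1 t.

Lemma tangent_isoK : cancel t (t^-1)%VF.
Proof. by apply/lker0_lfunK/lker0P/bij_inj/ti_bij. Qed.

Lemma tangent_isoKV : cancel (t^-1)%VF t.
Proof.
by move=> v; have [t' _ t'K] := ti_bij t; rewrite -(t'K v) tangent_isoK.
Qed.

Lemma tangent_Ad y X : t (Ad t y X) = tmap c c (conjugation y) 1%g (t X).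
Proof. by rewrite /Ad tangent_isoKV. Qed.

Lemma Ad_is_linear y : linear (Ad t y).
Proof. by move=> a X Y; rewrite /Ad /tmap !linearP. Qed.

Lemma AdM y z X : Ad t (y * z)%g X = Ad t y (Ad t z X).
Proof. by apply: (can_inj tangent_isoK); rewrite !tangent_Ad tmap_conjM. Qed.

Lemma Ad1 X : Ad t 1%g X = X.
Proof. by apply: (can_inj tangent_isoK); rewrite tangent_Ad tmap_conj1. Qed.

Lemma AdK y : cancel (Ad t y^-1%g) (Ad t y).
Proof. by move=> X; rewrite -AdM mulgV Ad1. Qed.

Let mu := loc_mul c.

(** Conjugation by x is the left translation by x followed by the right
    translation by the inverse of x; this is the chain rule for this composite,
    which takes 1 to x and x to 1. *)
Lemma diff_conjugation x v : loc_invertible c x ->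
  'd (cmap c \o conjugation (cinv c x) \o cinv c) (cmap c 1%g) v
  = 'd mu (x, loc_inv c x) ('d mu (x, cmap c 1%g) (0, v), 0).
Proof.
move=> cx; have [cxx cxi] := cx.
have dx1 : loc_dom c (x, cmap c 1%g).
  by split; rewrite /= ?cmapK ?mulg1 //; [exact: cmap_cimg|exact: cinv_cdom].
have mux1 : mu (x, cmap c 1%g) = x by rewrite /mu /loc_mul /= cmapK // mulg1 cinvK.
have d1 := is_diff_partialr (loc_mul_diff c_atlas dx1).
have d2 : is_diff (mu (x, cmap c 1%g)) (fun a => mu (a, loc_inv c x))
    (fun u => 'd mu (x, loc_inv c x) (u, 0)).
  by rewrite mux1; apply/is_diff_partiall/loc_mul_diff/loc_dom_invr.
have d3 := @is_diff_comp _ _ _ _ _ _ _ _ _ d1 d2.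
have near_eq : \forall w \near cmap c 1%g,
  ((fun a => mu (a, loc_inv c x)) \o (fun w => mu (x, w))) w
  = (cmap c \o conjugation (cinv c x) \o cinv c) w.
  have nU : nbhs (1%g : G) (fun z => cdom c (cinv c x * z)%g).
    apply: (@mulg_continuousr R G (cinv c x) 1%g); rewrite mulg1.
    exact/nbhs_cdom/cinv_cdom.
  have := near_cinv c1 nU; apply: filterS => w /= cw.
  by rewrite /mu /loc_mul /= cmapK // cinv_loc_inv.
by have d4 := near_eq_is_diff near_eq d3; rewrite (diff_val (is_diff_def := d4)).
Qed.

(** By the formula for the derivative of a conjugation, Ad is an expression in
    first derivatives of the group law, evaluated at points that depend smoothly
    on x.  The outer derivative is expanded in coordinates, because its direction
    q x varies with x. *)
Lemma Ad_diff Y : differentiable (fun x => t (Ad t (cinv c x) Y)) (cmap c 1%g).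
Proof.
pose e k : 'rV[R]_(@mdim R G) * 'rV[R]_(@mdim R G) := (delta_mx 0 k, 0).
pose q x := 'D_(0, t Y) mu (x, cmap c 1%g).
pose pr x : 'rV[R]_(@mdim R G) * 'rV[R]_(@mdim R G) := (x, loc_inv c x).
have near_eq : \forall x \near cmap c 1%g,
    (\sum_k (fun x => q x 0 k *: ('D_(e k) mu \o pr) x)) x = t (Ad t (cinv c x) Y).
  have := near_loc_invertible c1; apply: filterS => x cx.
  have dm := loc_mul_diff c_atlas (loc_dom_invr c1 cx).
  have dx1 : loc_dom c (x, cmap c 1%g).
    have [cxx _] := cx.
    by split; rewrite /= ?cmapK ?mulg1 //; [exact: cmap_cimg|exact: cinv_cdom].
  rewrite tangent_Ad /tmap diff_conjugation // fct_sumE.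
  have qE : 'd mu (x, cmap c 1%g) (0, t Y) = q x.
    by apply/esym/deriveE; exact: loc_mul_diff.
  apply: etrans (congr1 (fun z => 'd mu (x, loc_inv c x) (z, 0)) (esym qE)).
  have zE : (q x, 0) = \sum_k q x 0 k *: e k :> 'rV[R]_(@mdim R G) * 'rV[R]_(@mdim R G).
    rewrite [RHS]surjective_pairing !raddf_sum /=; congr (_, _).
      exact: row_sum_delta.
    by rewrite big1 // => k _; rewrite scaler0.
  apply: etrans (congr1 ('d mu (x, loc_inv c x)) (esym zE)).
  rewrite linear_sum; apply: eq_bigr => k _; rewrite linearZ; congr (_ *: _).
  by rewrite /= deriveE.
apply: near_eq_differentiable near_eq _; apply: differentiable_sum => k.
have ci := nbhs_singleton (near_loc_invertible c1).
have d11 : loc_dom c (cmap c 1%g, cmap c 1%g).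
  by split; rewrite /= ?cmapK ?mulg1 //; exact: cmap_cimg.
have dq : differentiable q (cmap c 1%g).
  pose pr1 x : 'rV[R]_(@mdim R G) * 'rV[R]_(@mdim R G) := (x, cmap c 1%g).
  apply: (@differentiable_comp _ _ _ _ pr1 ('D_(0, t Y) mu)).
    by apply: differentiable_pair; [exact: ex_diff|exact: differentiable_cst].
  exact: loc_mul_derive_diff.
have dD : differentiable ('D_(e k) mu \o pr) (cmap c 1%g).
  apply: differentiable_comp; last exact/loc_mul_derive_diff/(loc_dom_invr c1).
  by apply: differentiable_pair; [exact: ex_diff|exact: loc_inv_diff].
apply: differentiable_scale_rV dD.
exact: (differentiable_comp (g := fun N : 'rV[R]_(@mdim R G) => N 0 k) dq
  (differentiable_coord _ _ _)).
Qed.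

Variable br : g -> g -> g.
Hypothesis G_lie : lie_algebra_of t br.

Lemma diff_Ad X Y :
  'd (fun x => t (Ad t (cinv c x) Y)) (cmap c 1%g) (t X) = t (br X Y).
Proof. by rewrite -G_lie deriveE //; exact: Ad_diff. Qed.

(** Differentiate at x = 1 the identity
    Ad_y (Ad_x Y) = Ad_(y x y^-1) (Ad_y Y). *)
Lemma Ad_br y X Y : Ad t y (br X Y) = br (Ad t y X) (Ad t y Y).
Proof.
apply: (can_inj tangent_isoK); rewrite -diff_Ad !tangent_Ad -diff_Ad.
pose kappa := cmap c \o conjugation y \o cinv c.
have dk : differentiable kappa (cmap c 1%g) by exact: conjugation_diff.
have k1 : kappa (cmap c 1%g) = cmap c 1%g by rewrite /kappa /= cmapK // conjugation1.
pose F Z x := t (Ad t (cinv c x) Z).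
have dFk : is_diff (cmap c 1%g) (F (Ad t y Y) \o kappa)
    ('d (F (Ad t y Y)) (cmap c 1%g) \o 'd kappa (cmap c 1%g)).
  apply: is_diff_comp; first exact/differentiableP.
  by rewrite k1; exact/differentiableP/Ad_diff.
have dkF : is_diff (cmap c 1%g) ('d kappa (cmap c 1%g) \o F Y)
    ('d kappa (cmap c 1%g) \o 'd (F Y) (cmap c 1%g)).
  apply: is_diff_comp; last exact: linear_diff_rV.
  exact/differentiableP/Ad_diff.
have near_eq : \forall x \near cmap c 1%g,
    ('d kappa (cmap c 1%g) \o F Y) x = (F (Ad t y Y) \o kappa) x.
  have nU : nbhs (1%g : G) (fun z => cdom c (conjugation y z)).
    by apply: (@conjugation_continuous R G y 1%g); rewrite conjugation1; exact: nbhs_cdom.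
  have := near_cinv c1 nU; apply: filterS => x /= cx.
  rewrite -[LHS]tangent_Ad -AdM /F /kappa /= cmapK // -AdM.
  by rewrite /conjugation mulgVK.
have dE := near_eq_diff near_eq (ex_diff (is_diff_def := dkF)).
have eqf := etrans (esym (diff_val (is_diff_def := dkF)))
  (etrans dE (diff_val (is_diff_def := dFk))).
exact: (congr1 (fun f => f (t X)) eqf).
Qed.

End Adjoint.

Section AdjointSubgroup.
Variables (R : realType) (G : lieGroupType R) (g : vectType R) (t : tangent_iso G g).
Variable br : g -> g -> g.
Hypothesis G_lie : lie_algebra_of t br.
Variables (h : {vspace g}) (H : lieGroupType R) (iota : H -> G).
Hypothesis H_sub : connected_lie_subgroup t h iota.

Lemma subgroup_incl1 : iota 1%g = 1%g.
Proof.
have := clsub_morph H_sub 1%g 1%g; rewrite mulg1.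
by move=> /(congr1 (fun z => (z * (iota 1%g)^-1)%g)); rewrite mulgV mulgK.
Qed.

(** The derivative at the identity of x |-> Ad_(iota x) takes its values in the
    operators [X, _] with X in h. *)
Lemma Ad_invariant (W : {vspace g}) :
  (forall X Y, X \in h -> Y \in W -> br X Y \in W) ->
  forall y Y, Y \in W -> Ad t (iota y) Y \in W.
Proof.
move=> hW y Y YW.
have [c' ac' c1'] := atlas_cover (1%g : H).
pose c := ti_chart t.
pose J := cmap c \o iota \o cinv c'.
pose F Z x := t (Ad t (cinv c x) Z).
pose Phi Z u : 'rV[R]_(dim g) := v2r (Ad t (iota (cinv c' u)) Z).
have iota_cont : {for 1%g, continuous iota} by exact: (clsub_smooth H_sub).1.
have ci1 : cdom c (iota 1%g) by rewrite subgroup_incl1; exact: ti_dom1.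
have J1 : J (cmap c' 1%g) = cmap c 1%g by rewrite /J /= cmapK // subgroup_incl1.
have dJ : is_diff (cmap c' 1%g) J ('d J (cmap c' 1%g)).
  apply/differentiableP/(smooth_map_diff (clsub_smooth H_sub)) => //.
  exact: ti_atlas.
pose A : {linear 'rV[R]_(@mdim R G) -> 'rV[R]_(dim g)} := v2r \o (t^-1)%VF.
have dPhi Z : is_diff (cmap c' 1%g) (Phi Z)
    (A \o ('d (F Z) (cmap c 1%g) \o 'd J (cmap c' 1%g))).
  have near_eq : \forall u \near cmap c' 1%g, (A \o (F Z \o J)) u = Phi Z u.
    have := near_cinv c1' (iota_cont _ (nbhs_cdom ci1)); apply: filterS => u /= cu.
    by rewrite /F /J /= cmapK // tangent_isoK.
  apply: near_eq_is_diff near_eq _.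
  have dFJ : is_diff (cmap c' 1%g) (F Z \o J) ('d (F Z) (cmap c 1%g) \o 'd J (cmap c' 1%g)).
    by apply: is_diff_comp; rewrite J1; exact/differentiableP/Ad_diff.
  apply: is_diff_comp; exact: linear_diff_rV.
apply: (invariant_subspace (c := c') (P := fun y => Ad t (iota y))) => //.
- exact: clsub_connected H_sub.
- by move=> x; exact: Ad_is_linear.
- by move=> x z X; rewrite (clsub_morph H_sub) AdM.
- by move=> X; rewrite subgroup_incl1 Ad1.
move=> Z ZW v.
have := congr1 (fun f => r2v (f v)) (diff_val (is_diff_def := dPhi Z)).
rewrite /= v2rK => ->.
have [X tX] : exists X, t X = 'd J (cmap c' 1%g) v.
  by exists ((t^-1)%VF ('d J (cmap c' 1%g) v)); rewrite tangent_isoKV.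
have Xh : X \in h by apply/(clsub_lie H_sub ac' c1'); exists v.
by rewrite -tX (diff_Ad G_lie) tangent_isoK; apply: hW.
Qed.

End AdjointSubgroup.

(** * Smoothness and derivatives of the r-matrix *)

Section FatRMatrixCalculus.
Variables (R : realType) (g : vectType R) (br : g -> g -> g).
Hypothesis g_lie : lie_bracket br.
Variables (h m : {vspace g}) (U : set (hdual h)).
Hypothesis U_open : vopen U.
Hypothesis U_fat : fat_on br m U.
Variable e : (\dim m).-tuple g.
Hypothesis e_basis : basis_of m e.

Let D : set 'rV[R]_(dim (hdual h)) := (@r2v R (hdual h)) @^-1` U.
Let a (x : 'rV[R]_(dim (hdual h))) : 'M[R]_(\dim m) :=
  \matrix_(i, j) fat_form br m (r2v x) e`_i e`_j.
Let w (p : 'I_(\dim m) * 'I_(\dim m)) : 'rV[R]_(dim (ext g)) :=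
  2^-1 *: v2r (ext_wedge [:: e`_p.1; e`_p.2]).

Lemma fat_form_is_linear X Y : linear (fun l : hdual h => fat_form br m l X Y : R^o).
Proof. by move=> b l l'; rewrite /fat_form add_lfunE scale_lfunE. Qed.

Let a_linear i j : linear (fun x => a x i j : R^o).
Proof. by move=> b x y; rewrite /a !mxE linearP fat_form_is_linear. Qed.

Let a_lin i j : {linear 'rV[R]_(dim (hdual h)) -> R^o} :=
  HB.pack (fun x => a x i j : R^o)
    (GRing.isLinear.Build _ _ _ _ (fun x => a x i j : R^o) (a_linear i j)).

Let a_rational i j : rational_on D (fun x => a x i j).
Proof.
by apply: (@rational_lin _ _ _ (a_lin i j)); exact: continuous_linear_rV.
Qed.

Let a_unit x : D x -> a x \in unitmx.
Proof. by move=> Dx; apply: (fat_unitmx g_lie (U_fat Dx) e_basis). Qed.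

Let c_rational (p : 'I_(\dim m) * 'I_(\dim m)) :
  rational_on D (fun x => invmx (a x) p.1 p.2).
Proof. exact: rational_invmx. Qed.

Let rE x : D x -> (v2r \o fat_rmatrix br e \o r2v) x
  = \sum_p invmx (a x) p.1 p.2 *: w p.
Proof.
move=> _; rewrite /= /fat_rmatrix linearZ /= linear_sum /= scaler_sumr.
rewrite -(pair_bigA _ (fun i j => invmx (a x) i j *: w (i, j))) /=.
apply: eq_bigr => i _; rewrite linear_sum scaler_sumr; apply: eq_bigr => j _.
by rewrite linearZ /w !scalerA mulrC.
Qed.

Lemma fat_rmatrix_smooth : vsmooth_on U (fat_rmatrix br e).
Proof.
exact: (rational_smooth (F := fun p x => invmx (a x) p.1 p.2) U_open c_rational rE).
Qed.

Lemma fat_rmatrix_vderive l v : U l ->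
  let c := invmx (\matrix_(i, j) fat_form br m l e`_i e`_j) in
  vderive (fat_rmatrix br e) l v = 2^-1 *: \sum_(i < \dim m) \sum_(j < \dim m)
     (- (c *m (\matrix_(i, j) fat_form br m v e`_i e`_j) *m c)) i j
       *: ext_wedge [:: e`_i; e`_j].
Proof.
move=> Ul c.
have Dl : D (v2r l) by rewrite /D /= v2rK.
have cE : invmx (a (v2r l)) = c by rewrite /a v2rK.
have aD i j : 'D_(v2r v) (fun x => a x i j) (v2r l)
    = (\matrix_(i, j) fat_form br m v e`_i e`_j) i j.
  have da : is_diff (v2r l) (a_lin i j) (a_lin i j) by exact: linear_diff_rV.
  apply: etrans (deriveE _ (ex_diff (is_diff_def := da))) _.
  by rewrite (diff_val (is_diff_def := da)) /= /a !mxE v2rK.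
rewrite /vderive.
have [_ ->] := rational_vec_diff (F := fun p x => invmx (a x) p.1 p.2)
  U_open c_rational rE Dl.
apply: (can_inj (@v2rK R (ext g))); rewrite r2vK linearZ linear_sum /= scaler_sumr.
rewrite -(pair_bigA _ (fun i j =>
  'D_(v2r v) (fun x => invmx (a x) i j) (v2r l) *: w (i, j))) /=.
apply: eq_bigr => i _; rewrite linear_sum scaler_sumr; apply: eq_bigr => j _.
rewrite (derive_invmx U_open a_rational a_unit Dl aD) cE.
rewrite /w scalerA mulrC -scalerA; congr (_ *: _); exact: esym (linearZZ _ _ _).
Qed.

End FatRMatrixCalculus.

(** * The coadjoint action of the subgroup *)

Section SubgroupAction.
Variables (R : realType) (g : vectType R) (br : g -> g -> g).
Hypothesis g_lie : lie_bracket br.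
Variables (h m : {vspace g}).
Hypothesis hm : reductive br h m.
Variables (G : lieGroupType R) (t : tangent_iso G g).
Hypothesis G_lie : lie_algebra_of t br.
Variables (H : lieGroupType R) (iota : H -> G).
Hypothesis H_sub : connected_lie_subgroup t h iota.

Let A y : {linear g -> g} :=
  HB.pack (Ad t y) (GRing.isLinear.Build _ _ _ _ (Ad t y) (Ad_is_linear t y)).

Lemma coAdE y (l : hdual h) Z :
  (coAd t y l : 'Hom(subvs_of h, R^o)) Z
    = (l : 'Hom(subvs_of h, R^o)) (vsproj h (Ad t y (vsval Z))).
Proof.
pose f (X : subvs_of h) : R^o :=
  (l : 'Hom(subvs_of h, R^o)) (vsproj h (Ad t y (vsval X))).
have f_linear : linear f.
  by move=> b u v; rewrite /f linearP (Ad_is_linear t y) !linearP.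
exact: (lfunE (HB.pack f (GRing.isLinear.Build _ _ _ _ f f_linear)
  : {linear subvs_of h -> R^o})).
Qed.

Lemma Ad_subgroup_h y X : X \in h -> Ad t (iota y) X \in h.
Proof. by apply: (Ad_invariant G_lie H_sub) => Y Z Yh Zh; apply: (reductive_subalgebra hm). Qed.

Lemma Ad_subgroup_m y X : X \in m -> Ad t (iota y) X \in m.
Proof. by apply: (Ad_invariant G_lie H_sub) => Y Z Yh Zh; apply: (reductive_invariant hm). Qed.

Lemma subgroup_inclV y : (iota y)^-1%g = iota y^-1%g.
Proof. by apply: mulg1_eq; rewrite -(clsub_morph H_sub) mulgV (subgroup_incl1 H_sub). Qed.

Lemma val_h_part_Ad y X :
  vsval (h_part h m (Ad t (iota y) X)) = Ad t (iota y) (vsval (h_part h m X)).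
Proof.
rewrite -{1}(h_part_add hm X) [Ad _ _ _](linearD (A (iota y))).
rewrite (pred_linearD (h_part_is_linear h m)) linearD /=.
rewrite (h_part_id hm (Ad_subgroup_h y (subvsP _))).
by rewrite (h_part_eq0 hm (Ad_subgroup_m y (memv_pi _ _ _))) linear0 addr0.
Qed.

(** Ad_y is an automorphism of the bracket and commutes with the projection onto h
    along m. *)
Lemma fat_form_coAd y (l : hdual h) X Y :
  fat_form br m (coAd t (iota y)^-1%g l) (Ad t (iota y) X) (Ad t (iota y) Y)
  = fat_form br m l X Y.
Proof.
rewrite /fat_form -(Ad_br G_lie) coAdE val_h_part_Ad -AdM mulVg Ad1.
by rewrite vsvalK.
Qed.

End SubgroupAction.

Theorem theorem2p3 (R : realType) (g : vectType R) (br : g -> g -> g)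
  (g_lie : lie_bracket br)
  (h m : {vspace g}) (hm_reductive : reductive br h m)
  (G : lieGroupType R) (t : tangent_iso G g) (G_lie : lie_algebra_of t br)
  (H : lieGroupType R) (iota : H -> G) (H_sub : connected_lie_subgroup t h iota)
  (U : set (hdual h)) (U_open : vopen U) (U_fat : fat_on br m U)
  (hb : (\dim h).-tuple g) (hb_basis : basis_of h hb)
  (e : (\dim m).-tuple g) (e_basis : basis_of m e) :
  let r := fat_rmatrix br e in
  [/\ forall l, U l -> r l \in ext_pow 2 m,
      triangular_dynamical_rmatrix br t iota hb U r &
      nondegenerate_rmatrix br t hb U r].
Proof.
move=> r.
pose A y : {linear g -> g} :=
  HB.pack (Ad t y) (GRing.isLinear.Build _ _ _ _ (Ad t y) (Ad_is_linear t y)).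
split.
- by move=> l _; apply: fat_rmatrix_mem => x; exact: (basis_mem e_basis).
- split.
  + by move=> l _; apply: fat_rmatrix_mem => X _; exact: memvf.
  + exact: fat_rmatrix_smooth.
  + move=> y l Ul Ul'.
    rewrite -[Ad t (iota y)]/(A (iota y) : g -> g).
    apply: (fat_rmatrix_equivariant g_lie e_basis (A := A (iota y)) (A' := A ((iota y)^-1%g))
      (U_fat _ Ul) (U_fat _ Ul')).
    * by move=> X; exact: (Ad_subgroup_m hm_reductive G_lie H_sub).
    * by move=> X; rewrite (subgroup_inclV H_sub); exact: (Ad_subgroup_m hm_reductive G_lie H_sub).
    * exact: AdK.
    * by move=> X Y _ _; exact: (fat_form_coAd hm_reductive G_lie H_sub).
  + move=> l Ul; apply: (fat_dybe g_lie hm_reductive e_basis hb_basis (U_fat _ Ul)) => p.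
    exact: (fat_rmatrix_vderive g_lie U_open U_fat e_basis _ Ul).
move=> l y c Ul ac cy.
have L_linear : linear (left_field t c y).
  by move=> b X Y; rewrite /left_field /tmap !linearP.
pose L : {linear g -> 'rV[R]_(@mdim R G)} :=
  HB.pack (left_field t c y) (GRing.isLinear.Build _ _ _ _ (left_field t c y) L_linear).
have L_bij : bijective L.
  exact: (bij_comp (left_translation_bij (ti_atlas t) ac (ti_dom1 t) cy) (ti_bij t)).
exact: (poisson_nondegenerate g_lie hm_reductive e_basis hb_basis (U_fat _ Ul) L_bij).
Qed.
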